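(* Let $R$ be a domain and $t\in R$ a prime element, such that: (A1) $R_t\cap R_{tR}=R$ (intersection inside $\operatorname{Frac}R$); (A2) $R$ is weakly $5$-fold stable and the natural map $K_2^M(R)\to K_2(R)$ is an isomorphism; (A3) the group $(1+tR)^\times$ is generated by those of its elements which are of the form $1+tw$ with $w\in R^\times$. Then the square of abelian groups $$\begin{array}{ccc}(1+tR)^{\times}&\xrightarrow{\ j\ }&R^{\times}\\ {\scriptstyle\rho_t}\downarrow&&\downarrow{\scriptstyle\{\cdot,t\}}\\ K_2^M(R)&\longrightarrow&K_2^M(R_t)\end{array}$$ is co-Cartesian (i.e. it commutes and is a pushout square). Here $j$ is the inclusion, $\{\cdot,t\}$ is the map $u\mapsto\{u,t\}$, the bottom arrow is the natural map, and $\rho_t$ is regarded as taking values in $K_2^M(R)$ via the isomorphism $K_2^M(R)\cong K_2(R)$ of (A2).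
   Context: All rings are commutative, unital and Noetherian. A prime element of a ring is an element generating a non-zero, proper prime ideal. $R_t=R[t^{-1}]$, and $R_{tR}$ is the localisation of $R$ at the prime ideal $tR$. $(1+tR)^\times:=(1+tR)\cap R^\times$, a subgroup of $R^\times$. A ring $R$ is weakly $k$-fold stable ($k\ge1$) if whenever $b_1,\dots,b_{k-1}\in R$ are given, there exists $u\in R^\times$ such that $1+ub_1,\dots,1+ub_{k-1}$ are units. $K_2(R)=\operatorname{Ker}(St(R)\to E(R))$, where $St(R)$ is the (infinite) Steinberg group with standard generators $x_{ij}(a)$ ($a\in R$, $i\ne j$) and $E(R)$ is the group of infinite elementary matrices; $K_2(R)$ is written additively. For $a\in R^\times$ put $w_{ij}(a)=x_{ij}(a)x_{ji}(-a^{-1})x_{ij}(a)$ and $h_{ij}(a)=w_{ij}(a)w_{ij}(-1)$. For $a,b\in R^\times$ the Steinberg symbol is $\{a,b\}:=[h_{12}(a),h_{13}(b)]\in K_2(R)$. For $a,b\in R$ with $1+ab\in R^\times$ the Dennis–Stein symbol is $$\langle a,b\rangle=x_{21}\left(\tfrac{-b}{1+ab}\right)x_{12}(a)\,x_{21}(b)\,x_{12}\left(\tfrac{-a}{1+ab}\right)h_{12}(1+ab)^{-1}\in K_2(R).$$ $K_2^M(R)$ is the abelian group generated by symbols $\{a,b\}$, $a,b\in R^\times$, subject to bilinearity, $\{a,bc\}=\{a,b\}+\{a,c\}$ and $\{ac,b\}=\{a,b\}+\{c,b\}$, and the Steinberg relation $\{a,1-a\}=0$ whenever $a,1-a\in R^\times$.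 The natural map $K_2^M(R)\to K_2(R)$ sends $\{a,b\}$ to the Steinberg symbol $\{a,b\}$. For a non-zero-divisor $t\in R$, the map $\rho_t:(1+tR)^\times\to K_2(R)$ is defined by $\rho_t(1+ta)=\langle a,t\rangle$; it is a group homomorphism. *)

(* Defs.v *)
From HB Require Import structures.
From mathcomp Require Import all_boot all_order all_algebra generic_quotient.
From mathcomp Require Import ring_quotient fraction.
From mathcomp Require Import boolp classical_sets functions cardinality fsbigop.
From mathcomp Require Import ring.

Set Implicit Arguments.
Unset Strict Implicit.
Unset Printing Implicit Defensive.

Import GRing.Theory.

Local Open Scope group_scope.

(* Groups are Algebra.groupType's, written multiplicatively (also K_2 and
   K_2^M).  Abelian groups are those with a commutative law. *)

HB.mixin Record Group_isAbelian G of Group G := {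
  mulgC : forall x y : G, x * y = y * x
}.

#[short(type="abGroupType")]
HB.structure Definition AbGroup := {G of Group G & Group_isAbelian G}.

(* Co-Cartesian squares of abelian groups
      A --f--> B
      |g       |h
      v        v
      C --k--> D                                                             *)
Record cocartesian (A B C D : abGroupType)
    (f : A -> B) (g : A -> C) (h : B -> D) (k : C -> D) : Prop := {
  cocart_morph : [/\ {morph f : x y / x * y}, {morph g : x y / x * y},
                     {morph h : x y / x * y} & {morph k : x y / x * y}];
  cocart_commutes : forall a, h (f a) = k (g a);
  cocart_universal : forall (T : abGroupType)
      (p : {multiplicative B -> T}) (q : {multiplicative C -> T}),
    (forall a, p (f a) = q (g a)) ->
    exists r : {multiplicative D -> T},
      [/\ forall b, r (h b) = p b, forall c, r (k c) = q c
        & forall r' : {multiplicative D -> T},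
            (forall b, r' (h b) = p b) -> (forall c, r' (k c) = q c) ->
            r' =1 r]
}.

Definition generates (G : groupType) (S : G -> Prop) : Prop :=
  forall H : {pred G}, group_closed H -> (forall x, S x -> x \in H) ->
  forall x, x \in H.

Section Presentation.
Variable X : choiceType.

(* (x, true) stands for the generator x, (x, false) for its inverse. *)
Definition word := seq (X * bool).
Definition gen (x : X) : word := [:: (x, true)].
Definition word_inv (w : word) : word := rev [seq (p.1, ~~ p.2) | p <- w].
Definition word_comm (u v : word) : word :=
  u ++ v ++ word_inv u ++ word_inv v.

Variable rel : word -> word -> Prop.

Inductive pres_eq : word -> word -> Prop :=
| PresRefl w : pres_eq w w
| PresSym u v : pres_eq u v -> pres_eq v u
| PresTrans v u w : pres_eq u v -> pres_eq v w -> pres_eq u w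
| PresCat u u' v v' : pres_eq u u' -> pres_eq v v' ->
    pres_eq (u ++ v) (u' ++ v')
| PresCancel x b : pres_eq [:: (x, b); (x, ~~ b)] [::]
| PresRel u v : rel u v -> pres_eq u v.

Definition pres_eqb (u v : word) : bool := `[< pres_eq u v >].

Lemma pres_eqb_refl : reflexive pres_eqb.
Proof. by move=> w; apply/asboolP/PresRefl. Qed.

Lemma pres_eqb_sym : symmetric pres_eqb.
Proof. by move=> u v; apply/asboolP/asboolP => /PresSym. Qed.

Lemma pres_eqb_trans : transitive pres_eqb.
Proof.
by move=> v u w /asboolP uv /asboolP vw; apply/asboolP/(PresTrans uv vw).
Qed.

Canonical pres_equiv :=
  EquivRel pres_eqb pres_eqb_refl pres_eqb_sym pres_eqb_trans.

Definition presented := {eq_quot pres_equiv}%qT.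
HB.instance Definition _ := Choice.on presented.
HB.instance Definition _ : EqQuotient _ pres_equiv presented :=
  EqQuotient.on presented.

Definition pres_class (w : word) : presented := (\pi_presented w)%qT.
Definition pres_gen (x : X) : presented := pres_class (gen x).

Lemma pres_classP u v : pres_class u = pres_class v <-> pres_eq u v.
Proof. by split=> [/eqquotP/asboolP|uv]; last by apply/eqquotP/asboolP. Qed.

Lemma pres_reprK (x : presented) : pres_class (repr x) = x.
Proof. exact: reprK. Qed.

Lemma pres_repr w : pres_eq (repr (pres_class w)) w.
Proof. by apply/pres_classP; rewrite pres_reprK. Qed.

Lemma word_invK : involutive word_inv.
Proof.
move=> w; rewrite /word_inv map_rev revK -map_comp -[RHS]map_id.
by apply: eq_map => -[x b] /=; rewrite negbK.
Qed.

Lemma pres_mulV w : pres_eq (w ++ word_inv w) [::].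
Proof.
elim: w => [|[x b] w IH]; first exact: PresRefl.
rewrite /word_inv /= rev_cons -cats1 -/(word_inv w).
rewrite catA -cat1s.
apply: PresTrans (PresCancel x b).
rewrite -[X in pres_eq _ X]/([:: (x, b)] ++ ([::] ++ [:: (x, ~~ b)])).
by apply: PresCat; [exact: PresRefl|apply: PresCat => //; exact: PresRefl].
Qed.

Lemma pres_mulVl w : pres_eq (word_inv w ++ w) [::].
Proof. by have := pres_mulV (word_inv w); rewrite word_invK. Qed.

Lemma pres_inv u v : pres_eq u v -> pres_eq (word_inv u) (word_inv v).
Proof.
move=> uv; apply: (@PresTrans (word_inv u ++ (v ++ word_inv v))).
  rewrite -[X in pres_eq X]cats0; apply: PresCat; first exact: PresRefl.
  exact/PresSym/pres_mulV.
rewrite catA -[X in pres_eq _ X]cat0s; apply: PresCat; last exact: PresRefl.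
apply: PresTrans (pres_mulVl u).
by apply: PresCat; [exact: PresRefl|exact: PresSym].
Qed.

Definition pres_one : presented := pres_class [::].
Definition pres_mul (x y : presented) : presented :=
  pres_class (repr x ++ repr y).
Definition pres_invg (x : presented) : presented :=
  pres_class (word_inv (repr x)).

Lemma pres_mulE u v :
  pres_mul (pres_class u) (pres_class v) = pres_class (u ++ v).
Proof. by apply/pres_classP/PresCat; exact: pres_repr. Qed.

Lemma pres_invE w : pres_invg (pres_class w) = pres_class (word_inv w).
Proof. exact/pres_classP/pres_inv/pres_repr. Qed.

Fact pres_mulA : associative pres_mul.
Proof.
move=> x y z; rewrite -[x]pres_reprK -[y]pres_reprK -[z]pres_reprK.
by rewrite !pres_mulE catA.
Qed.

Fact pres_mul1 : left_id pres_one pres_mul.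
Proof. by move=> x; rewrite -[x]pres_reprK pres_mulE. Qed.

Fact pres_mulr1 : right_id pres_one pres_mul.
Proof. by move=> x; rewrite -[x]pres_reprK pres_mulE cats0. Qed.

Fact pres_mulVg : left_inverse pres_one pres_invg pres_mul.
Proof.
move=> x; rewrite -[x]pres_reprK pres_invE pres_mulE.
exact/(pres_classP _ [::])/pres_mulVl.
Qed.

Fact pres_mulgV : right_inverse pres_one pres_invg pres_mul.
Proof.
move=> x; rewrite -[x]pres_reprK pres_invE pres_mulE.
exact/(pres_classP _ [::])/pres_mulV.
Qed.

HB.instance Definition _ := isGroup.Build presented
  pres_mulA pres_mul1 pres_mulr1 pres_mulVg pres_mulgV.

Lemma pres_classM u v : pres_class (u ++ v) = pres_class u * pres_class v.
Proof. exact/esym/pres_mulE. Qed.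

Lemma pres_classV w : pres_class (word_inv w) = (pres_class w)^-1.
Proof. exact/esym/pres_invE. Qed.

Section Lift.
Variables (G : groupType) (f : X -> G).

Definition word_eval (w : word) : G :=
  \prod_(p <- w) (if p.2 then f p.1 else (f p.1)^-1).

Lemma word_eval_cat u v : word_eval (u ++ v) = word_eval u * word_eval v.
Proof. by rewrite /word_eval big_cat. Qed.

Lemma word_eval_gen x : word_eval (gen x) = f x.
Proof. by rewrite /word_eval big_seq1. Qed.

Lemma word_eval_inv w : word_eval (word_inv w) = (word_eval w)^-1.
Proof.
elim: w => [|[x b] w IH]; first by rewrite /word_eval !big_nil invg1.
rewrite /word_inv /= rev_cons -cats1 -/(word_inv w) word_eval_cat IH.
rewrite -[in RHS](cat1s (x, b)) word_eval_cat invgM; congr (_ * _).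
by rewrite /word_eval !big_seq1; case: b; rewrite /= ?invgK.
Qed.

Hypothesis f_rel : forall u v, rel u v -> word_eval u = word_eval v.

Lemma word_eval_eq u v : pres_eq u v -> word_eval u = word_eval v.
Proof.
elim=> {u v} [//|u v _ -> //|v u w _ -> _ -> //|u u' v v' _ uu' _ vv'|x b|//].
- by rewrite !word_eval_cat uu' vv'.
- rewrite -(cat1s (x, b)) word_eval_cat /word_eval !big_seq1 big_nil /=.
  by case: b; rewrite /= ?divgg ?mulVg.
Qed.

Definition pres_lift (x : presented) : G := word_eval (repr x).

Lemma pres_lift_class w : pres_lift (pres_class w) = word_eval w.
Proof. exact/word_eval_eq/pres_repr. Qed.

Lemma pres_lift_gen x : pres_lift (pres_gen x) = f x.
Proof. by rewrite pres_lift_class word_eval_gen. Qed.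

Fact pres_liftM : {morph pres_lift : x y / x * y}.
Proof.
move=> x y; rewrite -[x]pres_reprK -[y]pres_reprK -pres_classM.
by rewrite !pres_lift_class word_eval_cat.
Qed.

End Lift.
End Presentation.

Section Units.
Variable R : comUnitRingType.

Definition units := {x : R | x \is a GRing.unit}.
HB.instance Definition _ := SubChoice.on units.

Definition to_unit (x : R) (ux : x \is a GRing.unit) : units := exist _ x ux.

Definition units_one : units := to_unit (unitr1 R).
Definition units_mul (x y : units) : units :=
  to_unit (etrans (unitrMl (val x) (valP y)) (valP x)).
Definition units_inv (x : units) : units :=
  to_unit (etrans (unitrV (val x)) (valP x)).

Fact units_mulA : associative units_mul.
Proof. by move=> x y z; apply/val_inj/mulrA. Qed.
Fact units_mul1 : left_id units_one units_mul.
Proof. by move=> x; apply/val_inj/mul1r. Qed.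
Fact units_mulr1 : right_id units_one units_mul.
Proof. by move=> x; apply/val_inj/mulr1. Qed.
Fact units_mulV : left_inverse units_one units_inv units_mul.
Proof. by move=> x; apply/val_inj/mulVr/valP. Qed.
Fact units_mulrV : right_inverse units_one units_inv units_mul.
Proof. by move=> x; apply/val_inj/mulrV/valP. Qed.
HB.instance Definition _ := isGroup.Build units
  units_mulA units_mul1 units_mulr1 units_mulV units_mulrV.

Fact units_mulC (x y : units) : x * y = y * x.
Proof. exact/val_inj/mulrC. Qed.
HB.instance Definition _ := Group_isAbelian.Build units units_mulC.

End Units.

Section UnitsMap.
Variables (R S : comUnitRingType) (f : {rmorphism R -> S}).

Definition units_map (u : units R) : units S :=
  to_unit (rmorph_unit f (valP u)).

Lemma units_mapM : {morph units_map : x y / x * y}.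
Proof. by move=> x y; apply/val_inj/rmorphM. Qed.

End UnitsMap.

(* K_2^M(R): generators {a, b}, bilinearity, the Steinberg relation, and
   commutation of the generators, since the presentation is one of abelian
   groups. *)
Inductive milnor_rel (R : comUnitRingType) :
    word (units R * units R)%type -> word (units R * units R)%type -> Prop :=
| MilnorBilinr a b c :
    milnor_rel (gen (a, b * c)) (gen (a, b) ++ gen (a, c))
| MilnorBilinl a c b :
    milnor_rel (gen (a * c, b)) (gen (a, b) ++ gen (c, b))
| MilnorSteinberg a b : val b = (1 - val a)%R -> milnor_rel (gen (a, b)) [::]
| MilnorComm p q : milnor_rel (gen p ++ gen q) (gen q ++ gen p).

Section Milnor.
Variable R : comUnitRingType.

Definition K2M := presented (@milnor_rel R).
HB.instance Definition _ := Group.on K2M.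

Definition msymbol (a b : units R) : K2M := pres_gen (@milnor_rel R) (a, b).

Fact K2M_mulC (x y : K2M) : x * y = y * x.
Proof.
have gC p q b c : pres_eq (@milnor_rel R) ([:: (p, b)] ++ [:: (q, c)])
    ([:: (q, c)] ++ [:: (p, b)]).
  have gE r d : pres_class (@milnor_rel R) [:: (r, d)] =
      if d then pres_gen (@milnor_rel R) r else (pres_gen (@milnor_rel R) r)^-1.
    by case: d => //; rewrite -pres_classV.
  have gg r s : commute (pres_gen (@milnor_rel R) r) (pres_gen (@milnor_rel R) s).
    by rewrite /commute -!pres_classM; apply/pres_classP/PresRel/MilnorComm.
  apply/pres_classP; rewrite !pres_classM !gE.
  case: b c => -[]; [exact: gg|exact/commuteV/gg| |]; symmetry.
    exact/commuteV/gg.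
  exact/commuteV/commute_sym/commuteV/gg.
rewrite -[x]pres_reprK -[y]pres_reprK.
rewrite -[LHS]pres_classM -[RHS]pres_classM; apply/pres_classP.
elim: (repr x) => [|[p b] u IH]; first by rewrite cats0; exact: PresRefl.
have H : pres_eq (@milnor_rel R) ([:: (p, b)] ++ repr y)
    (repr y ++ [:: (p, b)]).
  elim: (repr y) => [|[q c] v IHv]; first exact: PresRefl.
  rewrite -(cat1s (q, c)) catA -[X in pres_eq _ _ X]catA.
  apply: PresTrans (PresCat (PresRefl _ [:: (q, c)]) IHv).
  by rewrite catA; apply: PresCat (gC _ _ _ _) (PresRefl _ _).
rewrite -(cat1s (p, b)) -catA.
apply: PresTrans (PresCat (PresRefl _ [:: (p, b)]) IH) _.
by rewrite !catA; apply: PresCat H (PresRefl _ _).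
Qed.
HB.instance Definition _ := Group_isAbelian.Build K2M K2M_mulC.

End Milnor.

Section MilnorMap.
Variables (R S : comUnitRingType) (f : {rmorphism R -> S}).

Definition K2M_map : K2M R -> K2M S := pres_lift
  (fun p : units R * units R => msymbol (units_map f p.1) (units_map f p.2)).

Fact K2M_map_rel u v : milnor_rel u v ->
  word_eval (fun p : units R * units R =>
    msymbol (units_map f p.1) (units_map f p.2)) u =
  word_eval (fun p : units R * units R =>
    msymbol (units_map f p.1) (units_map f p.2)) v.
Proof.
case=> {u v} [a b c|a c b|a b ab|p q]; rewrite ?word_eval_cat !word_eval_gen /=.
- rewrite units_mapM -pres_classM; exact/pres_classP/PresRel/MilnorBilinr.
- rewrite units_mapM -pres_classM; exact/pres_classP/PresRel/MilnorBilinl.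
- rewrite /word_eval big_nil; apply/(pres_classP _ _ [::])/PresRel.
  by apply: MilnorSteinberg; rewrite /= ab rmorphB rmorph1.
- exact: K2M_mulC.
Qed.

Lemma K2M_mapM : {morph K2M_map : x y / x * y}.
Proof. exact/pres_liftM/K2M_map_rel. Qed.

Lemma K2M_map_symbol a b :
  K2M_map (msymbol a b) = msymbol (units_map f a) (units_map f b).
Proof. exact/pres_lift_gen/K2M_map_rel. Qed.

End MilnorMap.

Section InfiniteMatrices.
Variable R : comUnitRingType.
Local Open Scope ring_scope.

(* The matrices indexed by nat x nat that differ from the identity in finitely
   many entries. *)
Definition finitary : pred (nat -> nat -> R) := fun A =>
  `[< exists N, forall i j, (N <= i)%N || (N <= j)%N -> A i j = (i == j)%:R >].

Definition infmx := {A : nat -> nat -> R | finitary A}.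
HB.instance Definition _ := SubChoice.on infmx.

Implicit Types A B C : infmx.

Lemma infmxP A B : (forall i j, val A i j = val B i j) -> A = B.
Proof. by move=> AB; apply/val_inj/funext => i; apply/funext => j. Qed.

Definition infmx_mulf A B (i j : nat) : R :=
  \sum_(k \in [set: nat]) (val A i k * val B k j).

Lemma infmx_mulf_ord A B i j N :
  (forall k, (N <= k)%N -> val A i k * val B k j = 0) ->
  infmx_mulf A B i j = \sum_(k < N) (val A i k * val B k j).
Proof.
move=> AB0; rewrite /infmx_mulf.
rewrite (fsbig_ord _ N (fun k => val A i k * val B k j)).
apply/esym/fsbig_widen => // k [_] /= /negP; rewrite -leqNgt.
exact: AB0.
Qed.

Lemma infmx_mulf_row A B i j (a : nat -> R) (s : seq nat) : uniq s ->
  (forall k, val A i k = if k \in s then a k else 0) ->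
  infmx_mulf A B i j = \sum_(k <- s) (a k * val B k j).
Proof.
move=> us As.
rewrite (infmx_mulf_ord (N := \max_(k <- s) k.+1)); last first.
  move=> k lek; rewrite As; case: ifP => [ks|_]; last by rewrite mul0r.
  by have := leq_trans (leq_bigmax_seq (F := succn) (P := xpredT) k ks isT) lek; rewrite ltnn.
rewrite (eq_bigr (fun k : 'I__ => if val k \in s then a k * val B k j else 0)).
  rewrite -big_mkcond -(big_mkord (mem s) (fun k => a k * val B k j)).
  rewrite -big_filter; apply/perm_big/uniq_perm => //.
    exact/filter_uniq/iota_uniq.
  move=> k; rewrite mem_filter mem_index_iota /= andbC.
  by case ks: (k \in s); rewrite ?andbF // andbT (leq_bigmax_seq (F := succn) (P := xpredT) k ks isT).
by move=> k _; rewrite As; case: ifP; rewrite ?mul0r.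
Qed.

Lemma infmx_bound A : exists N, forall i j,
  (N <= i)%N || (N <= j)%N -> val A i j = (i == j)%:R.
Proof. exact/asboolP/(valP A). Qed.

Lemma infmx_mulf_id A B i j : (forall k, val A i k = (i == k)%:R) ->
  infmx_mulf A B i j = val B i j.
Proof.
move=> Ai; rewrite (@infmx_mulf_row A B i j (fun=> 1) [:: i]) //.
  by rewrite big_seq1 mul1r.
by move=> k; rewrite Ai inE eq_sym; case: eqP.
Qed.

Lemma infmx_mulf_idr A B i j : (forall k, val B k j = (k == j)%:R) ->
  infmx_mulf A B i j = val A i j.
Proof.
move=> Bj; rewrite (infmx_mulf_ord (N := j.+1)); last first.
  by move=> k jk; rewrite Bj gtn_eqF // mulr0.
rewrite big_ord_recr big1 => [|k _]; last by rewrite Bj ltn_eqF ?mulr0 /=.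
by rewrite /= Bj eqxx mulr1 add0r.
Qed.

Fact infmx_mul_subproof A B : finitary (infmx_mulf A B).
Proof.
apply/asboolP; have [N1 A1] := infmx_bound A; have [N2 B1] := infmx_bound B.
exists (maxn N1 N2) => i j; rewrite !geq_max => /orP[] /andP[le1 le2].
  rewrite infmx_mulf_id => [|k]; first by rewrite B1 ?le2.
  by rewrite A1 ?le1.
rewrite infmx_mulf_idr => [|k]; first by rewrite A1 ?le1 ?orbT.
by rewrite B1 ?le2 ?orbT.
Qed.

Fact infmx_one_subproof : finitary (fun i j => (i == j)%:R).
Proof. by apply/asboolP; exists 0%N. Qed.

Definition infmx_mul A B : infmx := exist _ (infmx_mulf A B) (infmx_mul_subproof A B).
Definition infmx_one : infmx := 
  exist _ (fun i j => (i == j)%:R) infmx_one_subproof.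

Fact infmx_mul1 : left_id infmx_one infmx_mul.
Proof. by move=> A; apply: infmxP => i j; apply: infmx_mulf_id. Qed.

Fact infmx_mulr1 : right_id infmx_one infmx_mul.
Proof. by move=> A; apply: infmxP => i j; apply: infmx_mulf_idr. Qed.

Fact infmx_mulA : associative infmx_mul.
Proof.
move=> A B C; apply: infmxP => i l /=.
have [NA A1] := infmx_bound A; have [NB B1] := infmx_bound B.
pose N := maxn (maxn NA NB) (maxn i.+1 l.+1).
have [lNA lNB] : (NA <= N)%N /\ (NB <= N)%N.
  by rewrite /N !leq_max !leqnn !orbT.
have [iN lN] : (i < N)%N /\ (l < N)%N by rewrite /N !leq_max !leqnn !orbT.
have A0 k : (N <= k)%N -> val A i k = 0.
  move=> Nk /=; rewrite A1 ?(leq_trans lNA Nk) ?orbT //.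
  by rewrite ltn_eqF // (leq_trans iN).
have B0 : forall m k, (m < N)%N -> (N <= k)%N -> val B m k = 0.
  move=> m k mN Nk; rewrite B1 ?(leq_trans lNB Nk) ?orbT //.
  by rewrite ltn_eqF // (leq_trans mN).
have AB0 k : (N <= k)%N -> infmx_mulf A B i k = 0.
  move=> Nk; rewrite (infmx_mulf_ord (N := N)); last first.
    by move=> m Nm; rewrite A0 ?mul0r.
  by rewrite big1 // => m _; rewrite B0 ?mulr0.
rewrite (infmx_mulf_ord (N := N)); last by move=> k Nk; rewrite A0 ?mul0r.
rewrite (infmx_mulf_ord (N := N)); last first.
  by move=> k Nk; rewrite /= AB0 ?mul0r.
transitivity (\sum_(k < N) \sum_(m < N) (val A i k * val B k m * val C m l)).
  apply: eq_bigr => k _ /=; rewrite (infmx_mulf_ord (N := N)); last first.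
    by move=> m Nm; rewrite B0 ?mul0r.
  by rewrite mulr_sumr; apply: eq_bigr => m _; rewrite mulrA.
rewrite exchange_big /=; apply: eq_bigr => m _.
rewrite (infmx_mulf_ord (N := N)); last by move=> k Nk; rewrite A0 ?mul0r.
by rewrite mulr_suml.
Qed.

HB.instance Definition _ := isMonoid.Build infmx
  infmx_mulA infmx_mul1 infmx_mulr1.

Definition offdiag := {ij : nat * nat | ij.1 != ij.2}.
HB.instance Definition _ := SubChoice.on offdiag.
Definition off i j (ij : i != j) : offdiag := exist _ (i, j) ij.

Definition elemf (ij : offdiag) (a : R) (k l : nat) : R :=
  (k == l)%:R + a *+ ((k == (val ij).1) && (l == (val ij).2)).

Fact elem_subproof ij a : finitary (elemf ij a).
Proof.
apply/asboolP; exists (maxn (val ij).1 (val ij).2).+1 => k l klN.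
rewrite /elemf.
suff -> : (k == (val ij).1) && (l == (val ij).2) = false by rewrite addr0.
apply: contraTF klN => /andP[/eqP-> /eqP->].
by rewrite negb_or -!ltnNge !ltnS leq_maxl leq_maxr.
Qed.

(* e_ij(a), where ij : offdiag packages the pair of distinct indices. *)
Definition elem ij a : infmx := exist _ (elemf ij a) (elem_subproof ij a).

Lemma elem_mulE i j (ij : i != j) a A k l :
  val (elem (off ij) a * A)%g k l =
  val A k l + (if k == i then a * val A j l else 0).
Proof.
transitivity (infmx_mulf (elem (off ij) a) A k l); first by [].
case: eqP => [->|/eqP ki].
  rewrite (@infmx_mulf_row _ _ i l (fun k => if k == i then 1 else a) [:: i; j]).
  - by rewrite !big_cons big_nil eqxx mul1r [j == i]eq_sym (negPf ij) addr0.
  - by rewrite /= inE ij.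
  - move=> m; rewrite /= /elemf /= eqxx !inE [i == m]eq_sym.
    have [->|mi] := eqVneq m i; first by rewrite (negPf ij) addr0.
    by rewrite add0r /=; case: eqP.
rewrite infmx_mulf_id ?addr0 // => m.
by rewrite /= /elemf /= (negPf ki) addr0.
Qed.

Definition elem_prod (s : seq (offdiag * R)) : infmx :=
  (\prod_(p <- s) elem p.1 p.2)%g.

Definition elementary : pred infmx :=
  fun A => `[< exists s, A = elem_prod s >].

Definition E := {A : infmx | elementary A}.
HB.instance Definition _ := SubChoice.on E.

Fact elementary_closed : monoid_closed elementary.
Proof.
split; first by apply/asboolP; exists [::]; rewrite /elem_prod big_nil.
move=> A B /asboolP[s ->] /asboolP[s' ->]; apply/asboolP; exists (s ++ s').
by rewrite /elem_prod big_cat.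
Qed.
HB.instance Definition _ :=
  SubChoice_isSubMonoid.Build _ _ E elementary_closed.

Lemma elem_mulD ij a b : (elem ij a * elem ij b)%g = elem ij (a + b).
Proof.
case: ij => -[i j] /= ij; rewrite -[_ ij]/(off ij).
rewrite -[LHS](@mulg1 infmx) -[RHS](@mulg1 infmx) -mulgA.
apply: infmxP => k l; rewrite !elem_mulE; case: eqP => [->|]; last first.
  by rewrite !addr0.
by rewrite [j == i]eq_sym (negPf ij) addr0 mulrDl addrA [RHS]addrAC.
Qed.

Lemma elem0 ij : elem ij 0 = 1%g.
Proof. by apply: infmxP => k l; rewrite /= /elemf mul0rn addr0. Qed.

Definition elem_prodV (s : seq (offdiag * R)) : seq (offdiag * R) :=
  rev [seq (p.1, - p.2) | p <- s].

Lemma elem_prodVK s : (elem_prod s * elem_prod (elem_prodV s))%g = 1%g.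
Proof.
elim: s => [|[ij a] s IH]; first by rewrite /elem_prod !big_nil mulg1.
rewrite /elem_prodV /= rev_cons -cats1 -/(elem_prodV s) -cat1s.
have catE u v : elem_prod (u ++ v) = (elem_prod u * elem_prod v)%g.
  by rewrite /elem_prod big_cat.
rewrite !catE -mulgA [(elem_prod s * _)%g]mulgA IH mul1g /elem_prod !big_seq1 /=.
by rewrite elem_mulD subrr elem0.
Qed.

Lemma elem_prodVr s : (elem_prod (elem_prodV s) * elem_prod s)%g = 1%g.
Proof.
have := elem_prodVK (elem_prodV s); congr (_ * elem_prod _ = _)%g.
rewrite /elem_prodV map_rev revK -map_comp -[RHS]map_id.
by apply: eq_map => -[ij a]; rewrite /= opprK.
Qed.

Definition E_inv (A : E) : E :=
  let s := projT1 (cid (asboolP _ (valP A))) in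
  exist _ (elem_prod (elem_prodV s)) (asboolT (ex_intro _ _ erefl)).

Fact E_mulV : left_inverse 1%g E_inv (fun A B : E => A * B)%g.
Proof.
move=> A; apply: val_inj; rewrite /E_inv.
case: cid => s /= As; rewrite [X in (_ * X)%g]As; exact: elem_prodVr.
Qed.

Fact E_mulVr : right_inverse 1%g E_inv (fun A B : E => A * B)%g.
Proof.
move=> A; apply: val_inj; rewrite /E_inv.
case: cid => s /= As; rewrite [X in (X * _)%g]As; exact: elem_prodVK.
Qed.

HB.instance Definition _ := hasInv.Build E E_inv.
HB.instance Definition _ := Monoid_isGroup.Build E E_mulV E_mulVr.

Fact elemE_subproof ij a : elementary (elem ij a).
Proof. by apply/asboolP; exists [:: (ij, a)]; rewrite /elem_prod big_seq1. Qed.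

Definition elemE (ij : offdiag) (a : R) : E := 
  exist _ (elem ij a) (elemE_subproof ij a).

End InfiniteMatrices.

(* The index set is nat, 0 included; only its being countable matters. *)
Inductive steinberg_rel (R : comUnitRingType) :
    word (offdiag * R)%type -> word (offdiag * R)%type -> Prop :=
| SteinbergAdd ij a b : steinberg_rel
    (gen (ij, a) ++ gen (ij, b)) (gen (ij, (a + b)%R))
| SteinbergCommMul i j l (ij : i != j) (jl : j != l) (il : i != l) a b :
    steinberg_rel (word_comm (gen (off ij, a)) (gen (off jl, b)))
                  (gen (off il, (a * b)%R))
| SteinbergCommOne i j k l (ij : i != j) (kl : k != l) a b :
    j != k -> i != l ->
    steinberg_rel (word_comm (gen (off ij, a)) (gen (off kl, b))) [::].

Section K2.
Variable R : comUnitRingType.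

Definition St := presented (@steinberg_rel R).
HB.instance Definition _ := Group.on St.

Definition stx (ij : offdiag) (a : R) : St :=
  pres_gen (@steinberg_rel R) (ij, a).

Definition St_to_E : St -> E R :=
  pres_lift (fun p : offdiag * R => elemE p.1 p.2).

Fact St_to_E_rel u v : steinberg_rel u v ->
  word_eval (fun p : offdiag * R => elemE p.1 p.2) u =
  word_eval (fun p : offdiag * R => elemE p.1 p.2) v.
Proof.
have commE (x y z : E R) : x * y = z * (y * x) -> x * (y * (x^-1 * y^-1)) = z.
  by move=> xy; rewrite !mulgA xy !mulgA !mulgK.
have mxP (A B : E R) :
    (forall M : infmx R, (val A * M = val B * M)%g) -> A = B.
  by move=> AB; apply/val_inj; rewrite -[LHS]mulg1 -[RHS]mulg1 AB.
case=> {u v} [ij a b|i j l ij jl il a b|i j k l ij kl a b jk il].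
- rewrite word_eval_cat !word_eval_gen; exact/val_inj/elem_mulD.
- rewrite !word_eval_cat !word_eval_inv !word_eval_gen; apply: commE.
  apply: mxP => M; rewrite !valM -!mulgA /=; apply: infmxP => m n.
  rewrite !elem_mulE.
  have [->|mi] := eqVneq m i.
    rewrite (negPf ij) !eqxx [l == j]eq_sym (negPf jl) [l == i]eq_sym.
    by rewrite (negPf il) !addr0 mulrDr mulrA addrA.
  by rewrite [l == i]eq_sym (negPf il) !addr0.
- rewrite !word_eval_cat !word_eval_inv !word_eval_gen.
  apply: commE; rewrite {1}/word_eval big_nil mul1g.
  apply: mxP => M; rewrite !valM -!mulgA /=; apply: infmxP => m n.
  rewrite !elem_mulE (negPf jk) [l == i]eq_sym (negPf il) !addr0.
  by rewrite addrAC.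
Qed.

Lemma St_to_EM : {morph St_to_E : x y / x * y}.
Proof. exact/pres_liftM/St_to_E_rel. Qed.

Lemma St_to_E_x ij a : St_to_E (stx ij a) = elemE ij a.
Proof. exact/pres_lift_gen/St_to_E_rel. Qed.

Definition in_K2 : pred St := fun x => St_to_E x == 1.

Definition K2 := {x : St | in_K2 x}.
HB.instance Definition _ := SubChoice.on K2.

Lemma St_to_E1 : St_to_E 1 = 1.
Proof. by apply: (mulgI (St_to_E 1)); rewrite -St_to_EM !mulg1. Qed.

Lemma St_to_EV x : St_to_E x^-1 = (St_to_E x)^-1.
Proof.
by apply: (mulgI (St_to_E x)); rewrite -St_to_EM !divgg St_to_E1.
Qed.

Fact in_K2_closed : group_closed in_K2.
Proof.
split; first by rewrite unfold_in /in_K2 St_to_E1.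
move=> x y; rewrite !unfold_in /in_K2 => /eqP x1 /eqP y1.
by rewrite St_to_EM St_to_EV x1 y1 divgg.
Qed.
HB.instance Definition _ := SubChoice_isSubGroup.Build _ _ K2 in_K2_closed.

Fact offC_subproof (ij : offdiag) : (val ij).2 != (val ij).1.
Proof. by rewrite eq_sym; apply: (valP ij). Qed.
Definition offC (ij : offdiag) : offdiag := off (offC_subproof ij).

Definition stw (ij : offdiag) (a : R) : St :=
  stx ij a * stx (offC ij) (- a^-1)%R * stx ij a.
Definition sth (ij : offdiag) (a : R) : St := stw ij a * stw ij (-1)%R.

Definition i12 : offdiag := off (isT : 1%N != 2).
Definition i21 : offdiag := off (isT : 2%N != 1%N).
Definition i13 : offdiag := off (isT : 1%N != 3).

Definition steinberg_st (a b : R) : St :=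
  let x := sth i12 a in let y := sth i13 b in x * y * x^-1 * y^-1.

Definition dennis_stein_st (a b : R) : St :=
  let u := (1 + a * b)%R in
  stx i21 (- b / u)%R * stx i12 a * stx i21 b * stx i12 (- a / u)%R
    * (sth i12 u)^-1.

(* St acts on the rows of infinite matrices through E. *)
Let act (x : St) (M : infmx R) : infmx R := val (St_to_E x) * M.

Let actM x y M : act (x * y) M = act x (act y M).
Proof. by rewrite /act St_to_EM valM mulgA. Qed.

Let actP x y : (forall M, act x M = act y M) -> St_to_E x = St_to_E y.
Proof.
by move=> xy; apply/val_inj; have := xy 1; rewrite /act !mulg1.
Qed.

Let act_x i j (ij : i != j) a M k l :
  val (act (stx (off ij) a) M) k l =
  (val M k l + (if k == i then a * val M j l else 0))%R.
Proof. by rewrite /act St_to_E_x elem_mulE. Qed.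

Let eq_unit (u v c x y : R) : (u * v = 1 -> x - y = c * (u * v - 1) -> x = y)%R.
Proof. by move=> -> /eqP; rewrite subrr mulr0 subr_eq0 => /eqP. Qed.

Let act_w i j (ij : i != j) u M k l : u \is a GRing.unit ->
  val (act (stw (off ij) u) M) k l =
  (if k == i then u * val M j l else
   if k == j then - u^-1 * val M i l else val M k l)%R.
Proof.
move=> uu; rewrite /stw !actM /offC !act_x /=.
have uv := mulrV uu; move: (u^-1)%R uv => v uv.
rewrite !eqxx [j == i]eq_sym (negPf ij).
have [->|ki] := eqVneq k i.
  rewrite (negPf ij); apply: (eq_unit (c := (- sval M i l - u * sval M j l)%R) uv).
  by ring.
have [->|kj] := eqVneq k j; last by rewrite !addr0.
by apply: (eq_unit (c := (- sval M j l)%R) uv); ring.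
Qed.

Let act_h i j (ij : i != j) u M k l : u \is a GRing.unit ->
  val (act (sth (off ij) u) M) k l =
  (if k == i then u * val M i l else
   if k == j then u^-1 * val M j l else val M k l)%R.
Proof.
move=> uu; rewrite /sth actM !act_w ?unitrN1 //.
rewrite !eqxx [j == i]eq_sym (negPf ij) invrN1.
have [_|_] := eqVneq k i; first by ring.
by have [_|//] := eqVneq k j; ring.
Qed.

Fact steinberg_subproof (a b : units R) : in_K2 (steinberg_st (val a) (val b)).
Proof.
rewrite /in_K2 /steinberg_st; set x := sth _ _; set y := sth _ _.
suff xy : St_to_E (x * y) = St_to_E (y * x).
  by rewrite St_to_EM (St_to_EM _ x^-1) xy -!St_to_EM mulgK divgg St_to_E1.
apply: actP => M; apply: infmxP => k l.
rewrite (actM x) (actM y) /x /y /i12 /i13 !act_h ?(valP a) ?(valP b) //=.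
have [_|_] := eqVneq k 1%N; first by rewrite mulrCA.
by have [k2|_] := eqVneq k 2; have [k3|_] := eqVneq k 3 => //;
  move: k3; rewrite k2.
Qed.

Definition steinberg (a b : units R) : K2 :=
  exist _ (steinberg_st (val a) (val b)) (steinberg_subproof a b).

Fact dennis_stein_subproof (a b : R) : (1 + a * b)%R \is a GRing.unit ->
  in_K2 (dennis_stein_st a b).
Proof.
move=> uu; rewrite /in_K2 /dennis_stein_st; set u := (1 + a * b)%R in uu *.
set x := (_ * stx i12 (- a / u)%R).
suff xh : St_to_E x = St_to_E (sth i12 u) by rewrite St_to_EM xh St_to_EV divgg.
apply: actP => M; apply: infmxP => k l.
rewrite [RHS]act_h // /x !actM /i12 /i21 !act_x /=.
have := mulrV uu; move: (u^-1)%R; rewrite /u => v uv.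
have [->|_] := eqVneq k 1%N.
  by apply: (eq_unit (c := (- a * sval M 2 l)%R) uv); rewrite /=; ring.
have [->|_] := eqVneq k 2; last by rewrite !addr0.
apply: (eq_unit (c := (- b * sval M 1%N l + (- 1 + a * b * v) * sval M 2 l)%R) uv).
by rewrite /=; ring.
Qed.

Definition dennis_stein (a b : R) (u : (1 + a * b)%R \is a GRing.unit) : K2 :=
  exist _ (dennis_stein_st a b) (dennis_stein_subproof u).

End K2.

(* The natural map K_2^M(R) -> K_2(R): as the symbols generate K_2^M(R), a
   morphism is determined by its values on them. *)
Definition natural_K2 (R : comUnitRingType)
    (phi : {multiplicative K2M R -> K2 R}) : Prop :=
  forall a b : units R, phi (msymbol a b) = steinberg a b.

Lemma natural_K2_unique (R : comUnitRingType)
    (phi psi : {multiplicative K2M R -> K2 R}) :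
  natural_K2 phi -> natural_K2 psi -> phi =1 psi.
Proof.
move=> phiE psiE x; rewrite -[x]pres_reprK.
have m1 (f : {multiplicative K2M R -> K2 R}) : f 1 = 1.
  by apply: (mulgI (f 1)); rewrite -gmulfM !mulg1.
elim: (repr x) => [|[[a b] c] w IH]; first by rewrite [LHS]m1 [RHS]m1.
rewrite -cat1s pres_classM !gmulfM IH; congr (_ * _).
have sE : phi (msymbol a b) = psi (msymbol a b) by rewrite phiE psiE.
case: c; first exact: sE.
rewrite -[[:: _]]/(word_inv (gen (a, b))) pres_classV.
apply: (mulgI (phi (msymbol a b))); rewrite -gmulfM [in RHS]sE -gmulfM.
by rewrite [X in phi X]divgg [X in psi X]divgg !m1.
Qed.

Section RingHypotheses.
Variable R : comUnitRingType.
Local Open Scope ring_scope.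

Definition is_ideal (I : set R) : Prop :=
  [/\ I 0, forall x y, I x -> I y -> I (x + y) & forall a x, I x -> I (a * x)].

Definition noetherian : Prop := forall I : set R, is_ideal I ->
  exists (n : nat) (g : 'I_n -> R),
    forall x, I x <-> exists c : 'I_n -> R, x = \sum_(i < n) c i * g i.

Definition weakly_stable (k : nat) : Prop := forall b : 'I_k.-1 -> R,
  exists2 u, u \is a GRing.unit & forall i, 1 + u * b i \is a GRing.unit.

Variable t : R.

Definition principal : {pred R} := [pred x | `[< exists a, x = t * a >]].

(* idealr_closed includes properness (1 \notin _). *)
Definition prime_element : Prop :=
  [/\ t != 0, idealr_closed principal & prime_idealr_closed principal].

(* (1 + tR)^x, as a subgroup of R^x. *)
Definition in_oneplus : pred (units R) :=
  fun u => `[< exists a, val u = 1 + t * a >].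

Definition oneplus := {u : units R | in_oneplus u}.
HB.instance Definition _ := SubChoice.on oneplus.

Fact in_oneplus_closed : group_closed in_oneplus.
Proof.
split; first by apply/asboolP; exists 0; rewrite mulr0 addr0.
move=> u v /asboolP[a ua] /asboolP[b vb]; apply/asboolP.
exists ((a - b) / val v).
rewrite [val _]/(val u / val v); have vv := valP v.
apply: (mulIr vv); rewrite divrK // mulrDl mul1r mulrA divrK // ua vb.
by rewrite mulrBr -addrA [t * b + _]addrC subrK.
Qed.
HB.instance Definition _ :=
  SubChoice_isSubGroup.Build _ _ oneplus in_oneplus_closed.

Fact oneplus_mulC (u v : oneplus) : (u * v = v * u)%g.
Proof. by apply: val_inj; rewrite !valM mulgC. Qed.
HB.instance Definition _ := Group_isAbelian.Build oneplus oneplus_mulC.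

Definition oneplus_incl (u : oneplus) : units R := val u.

(* rho_t(1 + ta) = <a, t>; a is determined by 1 + ta when t is not a
   zero-divisor, see rhoE. *)
Definition oneplus_coef (u : oneplus) : R := projT1 (cid (asboolP _ (valP u))).

Lemma oneplus_coefE u : val (oneplus_incl u) = 1 + t * oneplus_coef u.
Proof. by rewrite /oneplus_coef; case: cid. Qed.

Fact rho_subproof u : 1 + oneplus_coef u * t \is a GRing.unit.
Proof. by rewrite mulrC -oneplus_coefE; apply: valP. Qed.

Definition rho (u : oneplus) : K2 R := dennis_stein (rho_subproof u).

Lemma rhoE (u : oneplus) (a : R) (ut : 1 + a * t \is a GRing.unit) :
  GRing.lreg t -> val (oneplus_incl u) = 1 + t * a -> rho u = dennis_stein ut.
Proof.
move=> tr; rewrite oneplus_coefE => /addrI/tr ua; apply: val_inj.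
by rewrite /= ua.
Qed.

End RingHypotheses.

Section Localisation.
Variables (R : idomainType) (t : R).
Local Open Scope ring_scope.

Local Notation "x %:F" := (FracField.tofrac x).

Definition in_away : pred {fraction R} :=
  fun x => `[< exists a n, x = a%:F / t%:F ^+ n >].

(* R_{tR} *)
Definition in_locprime : pred {fraction R} :=
  fun x => `[< exists a b, b \notin principal t /\ x = a%:F / b%:F >].

Fact in_away_closed : subring_closed in_away.
Proof.
have [t0|t0] := eqVneq t 0.
  have awayE x : (x \in in_away) = `[< exists a, x = a%:F >].
    apply/asboolP/asboolP => [[a [[|n] ->]]|[a ->]].
    - by exists a; rewrite divr1.
    - by exists 0; rewrite t0 rmorph0 expr0n /= invr0 mulr0.
    - by exists a, 0%N; rewrite divr1.
  split=> [|x y|x y]; rewrite !awayE; first by apply/asboolP; exists 1; rewrite rmorph1.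
    by move=> /asboolP[a ->] /asboolP[b ->]; apply/asboolP; exists (a - b); rewrite rmorphB.
  by move=> /asboolP[a ->] /asboolP[b ->]; apply/asboolP; exists (a * b); rewrite rmorphM.
have tF : t%:F != 0 by rewrite tofrac_eq0.
split=> [|x y|x y].
- by apply/asboolP; exists 1, 0%N; rewrite divr1 rmorph1.
- move=> /asboolP[a [n ->]] /asboolP[b [m ->]]; apply/asboolP.
  exists (a * t ^+ m - b * t ^+ n), (n + m)%N.
  rewrite rmorphB !rmorphM !rmorphXn /= exprD -!mulNr.
  by rewrite addf_div ?expf_neq0.
- move=> /asboolP[a [n ->]] /asboolP[b [m ->]]; apply/asboolP.
  exists (a * b), (n + m)%N.
  by rewrite rmorphM exprD mulf_div.
Qed.

(* R_t, as a subring of Frac R. *)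
Definition away := {x : {fraction R} | in_away x}.
HB.instance Definition _ := SubChoice.on away.
HB.instance Definition _ :=
  GRing.SubChoice_isSubComNzRing.Build _ _ away in_away_closed.

Definition away_unit : {pred away} :=
  [pred x : away | (val x != 0) && in_away (val x)^-1].
Definition away_inv (x : away) : away :=
  if x \in away_unit then insubd x (val x)^-1 else x.

Fact away_invE x : x \in away_unit -> val (away_inv x) = (val x)^-1.
Proof. by move=> ux; rewrite /away_inv ux insubdK //; case/andP: ux. Qed.

Fact away_mulV : {in away_unit, left_inverse 1 away_inv *%R}.
Proof.
move=> x ux; apply: val_inj; rewrite rmorphM rmorph1 /= away_invE // mulVf //.
by case/andP: ux.
Qed.

Fact away_intro_unit (x y : away) : y * x = 1 -> x \in away_unit.
Proof.
move=> /(congr1 val); rewrite rmorphM rmorph1 /= => yx.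
have x0 : val x != 0.
  by apply: contra_eq_neq yx => ->; rewrite mulr0 eq_sym oner_eq0.
rewrite inE x0 -[_^-1]mul1r -yx mulfK //; exact: valP.
Qed.

Fact away_inv_out : {in [predC away_unit], away_inv =1 id}.
Proof. by move=> x; rewrite inE /away_inv => /negPf->. Qed.

HB.instance Definition _ := GRing.ComNzRing_hasMulInverse.Build away
  away_mulV away_intro_unit away_inv_out.

Fact to_away_subproof (a : R) : in_away a%:F.
Proof. by apply/asboolP; exists a, 0%N; rewrite divr1. Qed.

Definition to_away (a : R) : away := exist _ a%:F (to_away_subproof a).

Fact to_away_zmod_morphism : zmod_morphism to_away.
Proof. by move=> a b; apply/val_inj; rewrite [LHS]/= [RHS]rmorphB rmorphB. Qed.
Fact to_away_monoid_morphism : monoid_morphism to_away.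
Proof.
split=> [|a b]; apply/val_inj; first by rewrite [LHS]/= [RHS]rmorph1 rmorph1.
by rewrite [LHS]/= [RHS]rmorphM rmorphM.
Qed.
HB.instance Definition _ :=
  GRing.isZmodMorphism.Build R away to_away to_away_zmod_morphism.
HB.instance Definition _ :=
  GRing.isMonoidMorphism.Build R away to_away to_away_monoid_morphism.

Fact away_t_unit : t != 0 -> to_away t \is a GRing.unit.
Proof.
move=> t0; rewrite [_ \in _]/(_ && _) /= tofrac_eq0 t0 /=.
by apply/asboolP; exists 1, 1%N; rewrite rmorph1 div1r.
Qed.

Definition symbol_t (t0 : t != 0) (u : units R) : K2M away :=
  msymbol (units_map to_away u) (to_unit (away_t_unit t0)).

End Localisation.

Lemma prime_element_neq0 (R : comUnitRingType) (t : R) :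
  prime_element t -> t != 0%R.
Proof. by case. Qed.

(* Main.v *)
From HB Require Import structures.
Require Import Defs.
From mathcomp Require Import all_boot all_order all_algebra fraction.
From mathcomp Require Import boolp ring.

Set Implicit Arguments.
Unset Strict Implicit.
Unset Printing Implicit Defensive.

Import GRing.Theory.

Local Open Scope ring_scope.

(** Every unit of R_t is t^m a for a unique integer m and a unique unit a
    of R, because t is prime.  Let T be an abelian group with maps p on R^x
    and q on K_2^M(R) that agree on (1 + tR)^x.  A morphism r on K_2^M(R_t)
    with r {a, t} = p a and r {a, b} = q {a, b} for units a, b of R is then
    forced by bilinearity:
    r {t^m a, t^n b} = q {a, b} + n p(a) - m p(b) + mn p(-1),
    since {t, t} = {-1, t} and {t, b} = - {b, t} in K_2^M(R_t).  This gives
    uniqueness ([pairing_away]).  For existence, the formula is bilinear, so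
    only the Steinberg relation for x and 1 - x has to be checked
    ([glue_pairing]).  By antisymmetry and the passage from x to 1/x the only
    case with content is x = t^m a with m > 0, where b = 1 - x is a unit of R
    in 1 + tR, and the relation reads q {a, b} = m p(b).  As p(b) is the image
    under q of <- t^(m-1) a, t>, this follows from
    m <a t^(m-1), t> = <a, t^m> = {-a, 1 + a t^m} in K_2(R) ([rho_power]).

    Thus the proof rests on relations between Dennis-Stein symbols, which
    are derived inside the Steinberg group: additivity in the first
    argument ([dsst_addl], which also says that rho_t is a morphism), the
    product rule <a, bc> = <ab, c> + <ca, b> ([dsst_mulr]), and the value at
    a unit a ([dsst_unit]).  They come from comparing two factorisations of
    one element ([dsst_LU]), or two conjugates of a central one ([dsst_scale]).

    Weak 5-fold stability of R is used for {x, -x} = 0 and hence for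
    antisymmetry, both for units of R and for t in R_t ([pairing_opp]).
    Commutativity of the square is checked on the generators 1 + tw of
    (1 + tR)^x with w a unit: rho_t (1 + tw) = {1 + tw, -w}^-1, which is
    {1 + tw, t} in K_2^M(R_t) because {1 + tw, - tw} = 0. *)

(** * Group morphisms and presented groups *)

Local Open Scope group_scope.

(** Applies an equation between two-letter words at the head of a
    right-associated word. *)
Lemma mulg_tail (G : groupType) (y z v : G) : y * z = v ->
  forall g, y * (z * g) = v * g.
Proof. by move=> <- g; rewrite mulgA. Qed.

Section Morph.
Variables (G H : groupType) (f : G -> H).
Hypothesis fM : {morph f : x y / (x * y)}.

Lemma morphg1 : f 1 = 1.
Proof. by apply: (mulgI (f 1)); rewrite -fM !mulg1. Qed.

Lemma morphgV x : f x^-1 = (f x)^-1.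
Proof. by apply: (mulgI (f x)); rewrite -fM !divgg morphg1. Qed.

Lemma morphgX x n : f (x ^+ n) = (f x ^+ n).
Proof. by elim: n => [|n IH]; rewrite ?morphg1 // !expgS fM IH. Qed.

Lemma multiplicative_of : exists g : {multiplicative G -> H}, g =1 f.
Proof.
by exists (Multiplicative.Pack (Multiplicative.Class
  (isMultiplicative.Build G H f fM))).
Qed.
End Morph.

Lemma pres_ind (X : choiceType) (rel : word X -> word X -> Prop)
    (P : presented rel -> Prop) :
  P 1 -> (forall y z, P y -> P z -> P (y * z)) ->
  (forall a, P (pres_gen rel a)) -> (forall a, P (pres_gen rel a)^-1) ->
  forall y, P y.
Proof.
move=> P1 PM Pg PV y; rewrite -[y]pres_reprK.
elim: (repr y) => [|[a b] wd IH]; first exact: P1.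
rewrite -cat1s pres_classM; apply: PM => //; case: b; first exact: Pg.
by rewrite -[[:: _]]/(word_inv (gen a)) pres_classV; apply: PV.
Qed.

(** * Conjugation in the Steinberg group *)

Section Steinberg.
Variable R : comUnitRingType.
Implicit Types (a b c u v : R) (i j k l : nat).

(** Total in both indices, so that generators can be written without
    carrying a proof that the indices differ; the diagonal values are dummies. *)
Definition offd i j : offdiag := insubd i12 (i, j).

Lemma offdE i j (ij : i != j) : off ij = offd i j.
Proof. by apply: val_inj; rewrite insubdK. Qed.

Lemma offdC i j : i != j -> offC (offd i j) = offd j i.
Proof.
move=> ij; rewrite -(offdE ij); have ji : j != i by rewrite eq_sym.
by rewrite -(offdE ji); apply: val_inj.
Qed.

Definition xst i j a : St R := stx (offd i j) a.

Lemma xstD i j a b : xst i j a * xst i j b = xst i j (a + b)%R.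
Proof.
rewrite /xst /stx /pres_gen -pres_classM.
exact/pres_classP/PresRel/SteinbergAdd.
Qed.

Lemma xst0 i j : xst i j 0%R = 1.
Proof. by apply: (mulgI (xst i j 0%R)); rewrite xstD addr0 mulg1. Qed.

Lemma xstV i j a : (xst i j a)^-1 = xst i j (- a)%R.
Proof. by apply: (mulgI (xst i j a)); rewrite xstD subrr xst0 divgg. Qed.

Lemma xst_swap i j l a b : i != j -> j != l -> i != l ->
  xst i j a * xst j l b = xst i l (a * b)%R * xst j l b * xst i j a.
Proof.
move=> ij jl il.
have : pres_class (@steinberg_rel R)
  (word_comm (gen (off ij, a)) (gen (off jl, b))) =
  pres_class (@steinberg_rel R) (gen (off il, (a * b)%R)).
  by apply/pres_classP/PresRel/SteinbergCommMul.
rewrite /word_comm !pres_classM !pres_classV !offdE => E.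
rewrite /xst /stx /pres_gen -E.
by rewrite !mulgA mulgVK mulgVK.
Qed.

Lemma xst_comm i j k l a b : i != j -> k != l -> j != k -> i != l ->
  xst i j a * xst k l b = xst k l b * xst i j a.
Proof.
move=> ij kl jk il.
have : pres_class (@steinberg_rel R)
  (word_comm (gen (off ij, a)) (gen (off kl, b))) =
  pres_class (@steinberg_rel R) [::].
  by apply/pres_classP/PresRel/SteinbergCommOne.
rewrite /word_comm !pres_classM !pres_classV !offdE => E.
apply: (mulIg (xst i j a)^-1); rewrite mulgK; apply: (mulIg (xst k l b)^-1).
rewrite divgg -!mulgA; exact: E.
Qed.

Lemma xst_swapV i j l a b : i != j -> j != l -> i != l ->
  xst j l b * xst i j a = xst i l (- (a * b))%R * xst i j a * xst j l b.
Proof.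
move=> ij jl il; rewrite -mulgA xst_swap // !mulgA xstD addNr xst0 mul1g //.
Qed.

Lemma xst_commutator i j l a b : i != j -> j != l -> i != l ->
  xst i l (a * b)%R = xst i j a * xst j l b * xst i j (- a)%R * xst j l (- b)%R.
Proof. by move=> ij jl il; rewrite xst_swap // -!xstV !mulgK. Qed.

(** [wst], [hst] and the symbols below are locked: otherwise matching
    a product against them would unfold them into their letters. *)
Definition wst i j u := locked (xst i j u * xst j i (- u^-1)%R * xst i j u).
Definition hst i j u := locked (wst i j u * wst i j (-1)%R).

Lemma wst_def i j u : wst i j u = xst i j u * xst j i (- u^-1)%R * xst i j u.
Proof. by rewrite /wst -lock. Qed.

Lemma hst_def i j u : hst i j u = wst i j u * wst i j (-1)%R.
Proof. by rewrite /hst -lock. Qed.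

Lemma wstE i j u : i != j -> stw (offd i j) u = wst i j u.
Proof. by move=> ij; rewrite /stw offdC // wst_def. Qed.

Lemma hstE i j u : i != j -> sth (offd i j) u = hst i j u.
Proof. by move=> ij; rewrite /sth !wstE // hst_def. Qed.

Lemma wstV i j u : (wst i j u)^-1 = wst i j (- u)%R.
Proof. by rewrite !wst_def !invgM !xstV opprK invrN opprK mulgA. Qed.

Lemma hstV i j u : (hst i j u)^-1 = wst i j 1%R * wst i j (- u)%R.
Proof. by rewrite hst_def invgM !wstV opprK. Qed.

Lemma xstJ i j k l a b : i != j -> k != l -> j != k -> i != l ->
  xst k l b ^ xst i j a = xst k l b.
Proof. by move=> ij kl jk il; rewrite conjgE -xst_comm //
  xstV (mulg_tail (xstD _ _ _ _)) addNr xst0 mul1g. Qed.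

Lemma xstJl i j l a b : i != j -> j != l -> i != l ->
  xst j l b ^ xst i j a = xst i l (- (a * b))%R * xst j l b.
Proof.
move=> ij jl il; apply: (mulgI (xst i j a)).
by rewrite -conjgC xst_swapV // !mulgA [xst i j a * _]xst_comm // eq_sym.
Qed.

Lemma xstJr i j l a b : i != j -> j != l -> i != l ->
  xst i j a ^ xst j l b = xst i l (a * b)%R * xst i j a.
Proof.
move=> ij jl il; apply: (mulgI (xst j l b)).
by rewrite -conjgC xst_swap // !mulgA [xst j l b * _]xst_comm // eq_sym.
Qed.

Section Conjugation.
Variables (i j k : nat) (u : R).
Hypotheses (ij : i != j) (ik : i != k) (jk : j != k) (uu : u \is a GRing.unit).

Let ji : j != i. Proof. by rewrite eq_sym. Qed.
Let ki : k != i. Proof. by rewrite eq_sym. Qed.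
Let kj : k != j. Proof. by rewrite eq_sym. Qed.

Lemma wstJ_ik a : xst i k a ^ wst i j u = xst j k (u^-1 * a)%R.
Proof.
rewrite wst_def !conjgM xstJ // xstJl // [(xst _ _ _ * xst _ _ _) ^ _]conjMg
  xstJl // [xst i k a ^ _]xstJ //.
rewrite -mulgA -(xst_comm a) // (mulg_tail (xstD _ _ _ _)).
rewrite mulNr opprK mulrA divrr // mul1r addNr xst0 mul1g //.
Qed.

Lemma wstJ_jk a : xst j k a ^ wst i j u = xst i k (- (u * a))%R.
Proof.
rewrite wst_def !conjgM xstJl // [(xst _ _ _ * xst _ _ _) ^ _]conjMg xstJl //
  [xst j k a ^ _]xstJ // -mulgA.
rewrite (xst_comm _ a) // (mulg_tail (xstD _ _ _ _)) mulNr mulrN !opprK mulKr //.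
by rewrite addNr xst0 mul1g xstJ.
Qed.

Lemma wstJ_ki a : xst k i a ^ wst i j u = xst k j (u * a)%R.
Proof.
rewrite wst_def !conjgM xstJr // [(xst _ _ _ * xst _ _ _) ^ _]conjMg xstJr //
  [xst k i a ^ _]xstJ // -mulgA.
rewrite (xst_comm _ a) // (mulg_tail (xstD _ _ _ _)) mulrN mulrK //.
by rewrite addNr xst0 mul1g xstJ // mulrC.
Qed.

Lemma wstJ_kj a : xst k j a ^ wst i j u = xst k i (- (u^-1 * a))%R.
Proof.
rewrite wst_def !conjgM xstJ // xstJr // [(xst _ _ _ * xst _ _ _) ^ _]conjMg
  xstJr // [xst k j a ^ _]xstJ // -mulgA.
rewrite -(xst_comm a) // (mulg_tail (xstD _ _ _ _)) mulrN mulNr mulrVK //.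
by rewrite addNr xst0 mul1g mulrC.
Qed.

(** Conjugation by w_ij(u) is already known on letters that involve a third
    index k, and x_ij(a) is the commutator of x_ik(a) and x_kj(1). *)
Lemma wstJ_ij a : xst i j a ^ wst i j u = xst j i (- (u^-1 ^+ 2 * a))%R.
Proof.
rewrite -[a in LHS]mulr1 (xst_commutator a 1 ik kj) // !conjMg !wstJ_ik !wstJ_kj.
rewrite !mulrN -xst_commutator //.
by rewrite mulr1 mulrN mulrAC expr2.
Qed.

Lemma wstJ_ji a : xst j i a ^ wst i j u = xst i j (- (u ^+ 2 * a))%R.
Proof.
rewrite -[a in LHS]mulr1 (xst_commutator a 1 jk ki) // !conjMg !wstJ_jk !wstJ_ki.
rewrite !mulrN -xst_commutator //.
by rewrite mulr1 mulNr mulrAC expr2.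
Qed.

End Conjugation.

(** The k-th entry of the diagonal matrix that is the image of [hst i j u]. *)
Definition wt i j u k : R := if k == i then u else if k == j then u^-1%R else 1%R.

Lemma wt_unit i j u k : u \is a GRing.unit -> wt i j u k \is a GRing.unit.
Proof. by move=> uu; rewrite /wt; do 2?case: ifP => _;
  rewrite ?unitrV ?unitr1. Qed.

Lemma wtV i j u k : wt i j u^-1%R k = (wt i j u k)^-1%R.
Proof. by rewrite /wt; do 2?case: ifP => _ //; rewrite invr1. Qed.

Lemma third_index i j : exists k, (i != k) && (j != k).
Proof.
exists (i + j).+1.
by rewrite !neq_ltn !ltnS leq_addr leq_addl.
Qed.

(** Like its diagonal matrix, h_ij(u) rescales each generator: conjugation
    by w_ij(u) moves the indices, and conjugation by w_ij(-1) moves them back. *)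
Lemma hstJ i j u k l a : i != j -> k != l -> u \is a GRing.unit ->
  xst k l a ^ hst i j u = xst k l (wt i j u^-1%R k * wt i j u l * a)%R.
Proof.
move=> ij kl uu; have ji : j != i by rewrite eq_sym.
have u1 : (-1 : R)%R \is a GRing.unit by rewrite unitrN1.
have [m /andP[im jm]] := third_index i j.
rewrite hst_def conjgM /wt.
have [ki|ki] := eqVneq k i; [|have [kj|kj] := eqVneq k j];
  (have [li|li] := eqVneq l i; [|have [lj|lj] := eqVneq l j]); subst;
  rewrite ?eqxx ?(negPf ij) ?(negPf ji) ?invrK // in kl *.
- by rewrite (wstJ_ij ij im jm uu) (wstJ_ji ij im jm u1); congr xst; ring.
- have [il jl] : i != l /\ j != l by rewrite ![_ == l]eq_sym.
  by rewrite (wstJ_ik ij il jl uu) (wstJ_jk ij il jl u1); congr xst; ring.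
- by rewrite (wstJ_ji ij im jm uu) (wstJ_ij ij im jm u1) invrN1; congr xst; ring.
- have [il jl] : i != l /\ j != l by rewrite ![_ == l]eq_sym.
  by rewrite (wstJ_jk ij il jl uu) (wstJ_ik ij il jl u1) invrN1; congr xst; ring.
- have [ik jk] : i != k /\ j != k by rewrite ![_ == k]eq_sym.
  by rewrite (wstJ_ki ij ik jk uu) (wstJ_kj ij ik jk u1) invrN1; congr xst; ring.
- have [ik jk] : i != k /\ j != k by rewrite ![_ == k]eq_sym.
  by rewrite (wstJ_kj ij ik jk uu) (wstJ_ki ij ik jk u1); congr xst; ring.
- rewrite !wst_def !conjgM !xstJ // 1?[_ == l]eq_sym 1?[_ == k]eq_sym //.
  by congr xst; ring.
Qed.

Definition central (g : St R) := forall s, commute g s.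

Lemma central_xst (g : St R) :
  (forall i j a, i != j -> commute g (xst i j a)) -> central g.
Proof.
move=> gx s; rewrite -[s]pres_reprK.
elim: (repr s) => [|[[[[i j] /= ij] a] b] wd IH]; first exact: commute1.
rewrite -cat1s pres_classM; apply: commuteM => //.
have gij : commute g (pres_class (@steinberg_rel R) (gen (off ij, a))).
  by rewrite offdE; apply: gx.
case: b; first exact: gij.
rewrite -[[:: _]]/(word_inv (gen (off ij, a))) pres_classV.
exact: commuteV.
Qed.

Lemma hstJV i j u k l a : i != j -> k != l -> u \is a GRing.unit ->
  xst k l a ^ (hst i j u)^-1 = xst k l (wt i j u k * wt i j u^-1%R l * a)%R.
Proof.
move=> ij kl uu; apply: (conjg_inj (hst i j u)); rewrite conjgKV hstJ // !wtV.
have uk := wt_unit i j k uu; have ul := wt_unit i j l uu; congr xst.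
rewrite -!mulrA [RHS]mulrCA mulKr //; rewrite mulVKr //.
Qed.

Definition symbst u v :=
  locked (hst 1 2 u * hst 1 3 v * (hst 1 2 u)^-1 * (hst 1 3 v)^-1).

Lemma symbst_def u v :
  symbst u v = hst 1 2 u * hst 1 3 v * (hst 1 2 u)^-1 * (hst 1 3 v)^-1.
Proof. by rewrite /symbst -lock. Qed.

Lemma steinbergE (u v : units R) : val (steinberg u v) = symbst (val u) (val v).
Proof. by rewrite /= /steinberg_st /i12 /i13 !offdE !hstE // symbst_def. Qed.

(** Both entries of the commutator act on a generator by rescaling, and
    rescalings commute; so the commutator acts trivially. *)
Lemma symbst_central u v : u \is a GRing.unit -> v \is a GRing.unit ->
  central (symbst u v).
Proof.
move=> uu uv; apply: central_xst => i j a ij.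
rewrite /commute [RHS]conjgC; congr (_ * _).
rewrite symbst_def !conjgM hstJ // hstJ // hstJV // hstJV // !wtV.
have := wt_unit 1 2 i uu; have := wt_unit 1 2 j uu.
have := wt_unit 1 3 i uv; have := wt_unit 1 3 j uv.
move: (wt 1 3 _ _) (wt 1 3 _ _) (wt 1 2 _ _) (wt 1 2 _ _) => p q r s up uq ur us.
congr xst; transitivity (p / p * (q / q) * (r / r) * (s / s) * a)%R.
  by rewrite !mulrV // !mul1r.
by ring.
Qed.

(** * Dennis-Stein symbols *)

Definition dsst i j a b := let u := (1 + a * b)%R in
  locked (xst j i (- b / u)%R * xst i j a * xst j i b * xst i j (- a / u)%R *
    (hst i j u)^-1).

Lemma dsst_def i j a b : let u := (1 + a * b)%R in
  dsst i j a b =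
    xst j i (- b / u)%R * xst i j a * xst j i b * xst i j (- a / u)%R *
      (hst i j u)^-1.
Proof. by rewrite /dsst -lock. Qed.

Lemma dennis_steinE a b (u : (1 + a * b)%R \is a GRing.unit) :
  val (dennis_stein u) = dsst 1 2 a b.
Proof. by rewrite /= /dennis_stein_st /i12 /i21 !offdE hstE // dsst_def. Qed.

(** The symbol measures how far, in the Steinberg group, the product
    x_ij(a) x_ji(b) is from its factorisation into lower triangular, diagonal
    and upper triangular parts.  Factoring one element in two ways therefore
    yields relations between symbols. *)
Lemma dsst_LU i j a b : let u := (1 + a * b)%R in
  xst i j a * xst j i b = xst j i (b / u)%R * dsst i j a b * hst i j u * xst i
    j (a / u)%R.
Proof.
rewrite /= dsst_def !mulgA mulgVK xstD mulNr subrr xst0 mul1g.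
by rewrite -[RHS]mulgA xstD mulNr addNr xst0 mulg1.
Qed.

Lemma dsst_of_LU i j a b g : let u := (1 + a * b)%R in
  xst i j a * xst j i b = xst j i (b / u)%R * g * hst i j u * xst i j (a / u)%R ->
  commute g (hst i j u) ->
  dsst i j a b = g.
Proof.
move=> u E gh; rewrite dsst_def -/u -(mulgA (xst j i _)) E !mulgA xstD mulNr
  addNr xst0 mul1g.
by rewrite -(mulgA _ (xst i j _) (xst i j _)) xstD mulNr subrr xst0 mulg1 mulgK.
Qed.

(** Conjugation by w_ij(u) turns x_ij(u) into x_ji(- 1/u), so the first
    letter of w_ij(u) can be carried across to its right end. *)
Lemma wst_flip i j u : i != j -> u \is a GRing.unit -> wst i j u = wst j i
  (- u^-1)%R.
Proof.
move=> ij uu; have [k /andP[ik jk]] := third_index i j.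
have := conjgC (xst i j u) (wst i j u).
rewrite (wstJ_ij ij ik jk uu) expr2 mulrVK // {1 2}wst_def -!mulgA => /mulgI E.
by rewrite !wst_def -mulgA E invrN invrK opprK -!mulgA.
Qed.

Lemma wstJ_wst i j u v : i != j -> u \is a GRing.unit -> v \is a GRing.unit ->
  wst i j u ^ wst i j v = wst i j (v ^+ 2 / u)%R.
Proof.
move=> ij uu uv; have [k /andP[ik jk]] := third_index i j.
have ji : j != i by rewrite eq_sym.
rewrite {1}wst_def !(conjMg (_ : St R)) !(wstJ_ij ij ik jk uv)
  !(wstJ_ji ij ik jk uv).
have v2 : (v^-1 ^+ 2)%R \is a GRing.unit by rewrite unitrX ?unitrV.
have uV : v^-1%R \is a GRing.unit by rewrite unitrV.
have E : (v ^+ 2 / u)%R = (v^-1 ^+ 2 * u)^-1%R.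
  by rewrite invrM // exprVn invrK mulrC.
have su : (v^-1 ^+ 2 * u)%R \is a GRing.unit by rewrite unitrMl.
rewrite mulrN opprK {}E; move: (v^-1 ^+ 2 * u)%R su => s su.
by rewrite [RHS]wst_flip ?unitrV // wst_def !invrK invrN opprK.
Qed.

(** The letters x_ij(-1) x_ji(b) x_ij(1/u), with u = 1 - b, contain
    w_ij(-1) and w_ij(1/u) up to letters that cancel, and the remaining
    product of w's is trivial by [wstJ_wst]. *)
Lemma dsst_N1 i j b : i != j -> (1 - b)%R \is a GRing.unit -> dsst i j (-1)%R b
  = 1.
Proof.
move=> ij uu; rewrite dsst_def /= mulN1r opprK; set u := (1 - b)%R in uu *.
have [k /andP[ik jk]] := third_index i j.
have ji : j != i by rewrite eq_sym.
have n1 : (-1 : R)%R \is a GRing.unit by rewrite unitrN1.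
have E1 : xst i j (-1)%R * xst j i 1%R = wst i j (-1)%R * xst i j 1%R.
  by rewrite wst_def invrN1 opprK -[RHS]mulgA xstD addNr xst0 mulg1.
have E2 g : xst i j 1%R * (xst j i (- u)%R * (xst i j u^-1%R * g)) =
    xst i j (1 - u^-1)%R * (wst i j u^-1%R * g).
  by rewrite wst_def invrK !mulgA xstD subrK.
have E3 c g : wst i j (-1)%R * (xst i j c * g) = xst j i (- c)%R *
  (wst i j (-1)%R * g).
  by rewrite !mulgA [xst j i _ * _]conjgC (wstJ_ji ij ik jk n1) sqrrN expr1n
    mul1r opprK.
have E4 : wst i j (-1)%R * (wst i j u^-1%R * wst i j 1%R) = wst i j u.
  rewrite -[wst i j (-1)%R](wstV i j 1%R) -conjgE wstJ_wst ?unitrV ?unitr1 //.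
  by rewrite expr1n mul1r invrK.
have -> : xst j i b = xst j i 1%R * xst j i (- u)%R.
  by rewrite xstD; congr xst; rewrite /u; ring.
rewrite div1r -!mulgA (mulg_tail E1) -!mulgA E2 E3 hstV
  2?(mulgA (wst i j u^-1%R)) (mulgA (wst i j (-1)%R)) E4.
rewrite -(wstV i j u) divgg mulg1 xstD -(xst0 j i); congr xst.
apply: (mulIr uu); rewrite mul0r mulrDl divrK // mulNr mulrBl mulVr // /u.
by ring.
Qed.

(** Splitting x_ji(1) as x_ij(1) w_ij(-1) x_ij(1) produces the triangular
    factorisation of x_ij(a) x_ji(1) with trivial error term. *)
Lemma dsst_r1 i j a : i != j -> (1 + a)%R \is a GRing.unit -> dsst i j a 1%R = 1.
Proof.
move=> ij uu; apply: dsst_of_LU; last exact/commute_sym/commute1.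
rewrite mulr1 mulg1; set u := (1 + a)%R in uu *.
have [k /andP[ik jk]] := third_index i j.
have ji : j != i by rewrite eq_sym.
have n1 : (-1 : R)%R \is a GRing.unit by rewrite unitrN1.
have E1 : xst j i 1%R = xst i j 1%R * wst i j (-1)%R * xst i j 1%R.
  by rewrite wst_def invrN1 opprK !mulgA xstD subrr xst0 mul1g -mulgA xstD
    addNr xst0 mulg1.
have E2 : xst i j u = xst j i u^-1%R * wst i j u * xst j i u^-1%R.
  by rewrite wst_flip // wst_def invrN invrK opprK !mulgA xstD subrr xst0 mul1g
    -mulgA xstD addNr xst0 mulg1.
rewrite E1 mul1r hst_def !mulgA xstD [(a + 1)%R]addrC -/u E2.
rewrite -!mulgA; congr (_ * (_ * _)).
rewrite !mulgA [xst j i _ * wst i j _]conjgC (wstJ_ji ij ik jk n1) -mulgA xstD;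
  congr (_ * xst _ _ _).
rewrite sqrrN expr1n mul1r -[X in (_ + X)%R](divrr uu) -mulN1r -mulrDl.
by rewrite /u addKr.
Qed.
End Steinberg.

Section DennisStein.
Variable R : comUnitRingType.
Implicit Types (a b c u v : R).
(** Dennis-Stein symbols lie in K_2, whose centrality is deduced in
    [K2_central] for rings with K_2 generated by Steinberg symbols. *)
Hypothesis dsC : forall a b, (1 + a * b)%R \is a GRing.unit -> central
  (dsst 1 2 a b).

(** For distinct indices, h_ik(v) rescales the two kinds of letters of
    w_ij(u) by inverse factors, which is what makes the result a w again. *)
Lemma wstJ_hst i j k u v : i != j -> i != k -> j != k ->
  u \is a GRing.unit -> v \is a GRing.unit ->
  wst i j u ^ hst i k v = wst i j (v^-1 * u)%R.
Proof.
move=> ij ik jk uu uv; have ji : j != i by rewrite eq_sym.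
rewrite !wst_def !(conjMg (_ : St R)) !hstJ //
  /wt !eqxx (negPf ji) (negPf jk) !mulr1 mul1r.
by rewrite invrM ?unitrV // invrK mulrN [(_^-1 * v)%R]mulrC.
Qed.

(** The quotient h_12(uv) h_12(v)^-1 equals w_12(uv) w_12(-v), which is the
    conjugate of h_12(u) by h_13(v)^-1; hence the commutator of h_12(u)
    and h_13(v) appears. *)
Lemma hstM u v : u \is a GRing.unit -> v \is a GRing.unit ->
  hst 1 2 u * hst 1 2 v = symbst u v * hst 1 2 (u * v)%R.
Proof.
move=> uu uv; apply: (mulIg (hst 1 2 v)^-1); rewrite mulgK.
have -> : symbst u v * hst 1 2 (u * v)%R * (hst 1 2 v)^-1 = symbst u v *
  (wst 1 2 (u * v)%R * wst 1 2 (- v)%R).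
  by rewrite hstV hst_def -(wstV _ _ 1%R) -!mulgA mulKg.
set A := _ * wst 1 2 _.
have E : A ^ hst 1 3 v = hst 1 2 u.
  rewrite /A (conjMg (_ : St R)) !wstJ_hst ?unitrN ?unitrMl //
    hst_def mulrN mulVr //.
  by rewrite mulrCA mulVr // mulr1.
have {}E : (hst 1 3 v)^-1 * A = hst 1 2 u * (hst 1 3 v)^-1.
  by rewrite -E conjgE -!mulgA divgg mulg1.
by rewrite symbst_def -!mulgA E mulKg mulgA mulgK.
Qed.

(** Conjugation by h_13(v) fixes the central symbol and rescales the four
    letters of its word; the last factor h_12(1 + ab) contributes the
    commutator that is the Steinberg symbol of 1 + ab and v. *)
Lemma dsst_scale a b v : (1 + a * b)%R \is a GRing.unit -> v \is a GRing.unit ->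
  dsst 1 2 a b = dsst 1 2 (v * a)%R (v^-1 * b)%R * symbst (1 + a * b)%R v.
Proof.
move=> uu uv.
have <- : dsst 1 2 a b ^ (hst 1 3 v)^-1 = dsst 1 2 a b.
  by rewrite conjgE (dsC uu) mulKg.
have abE : (v * a * (v^-1 * b) = a * b)%R by rewrite mulrACA divrr // mul1r.
rewrite !dsst_def !(conjMg (_ : St R)) !hstJV // /wt !eqxx !mulr1 !mul1r /= abE.
rewrite conjgE invgK symbst_def -!mulgA mulKg !mulrA !mulrN.
by rewrite ?mulrA ?mulNr.
Qed.

Lemma dsst_LU12 a b (u := (1 + a * b)%R) : u \is a GRing.unit ->
  xst 1 2 a * xst 2 1 b =
  dsst 1 2 a b * (xst 2 1 (b / u)%R * hst 1 2 u * xst 1 2 (a / u)%R).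
Proof. by move=> uu; rewrite dsst_LU -(dsC uu (xst 2 1 _)) -!mulgA. Qed.

(** With u = 1 + ab, the element x_12(cu) x_12(a) x_21(b) is factored once
    after adding the two x_12, and once by factoring the right pair and then
    the left pair.  The second way gives the symbol <cu, b/u>, and the Steinberg
    symbol that turns it into <c, b> is the one by which h_12 fails to be
    multiplicative. *)
Lemma dsst_addl a c b : (1 + a * b)%R \is a GRing.unit ->
  (1 + c * b)%R \is a GRing.unit ->
  dsst 1 2 (a + c * (1 + a * b))%R b = dsst 1 2 a b * dsst 1 2 c b.
Proof.
move=> uu uu'; have Ev : (1 + (a + c * (1 + a * b)) * b = (1 + c * b) *
  (1 + a * b))%R by ring.
have uv : (1 + (a + c * (1 + a * b)) * b)%R \is a GRing.unit by rewrite Ev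
  unitrMl.
have := dsst_LU12 uv; rewrite Ev.
set u := (1 + a * b)%R in uu Ev uv *; set u' := (1 + c * b)%R in uu' Ev uv *.
have Ew : (1 + (u * c) * (u^-1 * b) = u')%R.
  by rewrite mulrACA divrr // mul1r.
have uw : (1 + (u * c) * (u^-1 * b))%R \is a GRing.unit by rewrite Ew.
(* The factorisation after adding the two letters is in the hypothesis. *)
have -> : xst 1 2 (a + c * u)%R = xst 1 2 (c * u)%R * xst 1 2 a by rewrite xstD
  addrC.
rewrite -mulgA (dsst_LU12 uu) -/u.
rewrite mulgA -(dsC uu) -!mulgA.
rewrite [(c * u)%R]mulrC [(b / u)%R]mulrC.
rewrite (mulg_tail (dsst_LU12 uw)) Ew -!mulgA.
rewrite (mulg_tail (conjgC _ (hst 1 2 u))) hstJ // -!mulgA xstD.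
rewrite (mulg_tail (hstM uu' uu)) -!mulgA.
have cs := symbst_central uu' uu.
rewrite (mulg_tail (esym (cs (xst 2 1 _)))) -!mulgA
  (mulg_tail (esym (dsst_scale uu' uu))).
rewrite [X in xst 2 1 X * _](_ : _ = b / (u' * u))%R; last first.
  by rewrite invrM // mulrCA mulrA.
rewrite [X in _ * xst 1 2 X](_ : _ = (a + u * c) / (u' * u))%R; last first.
  rewrite /wt /= invrM // mulrA.
  have : (u * u^-1 = 1)%R by rewrite divrr.
  have : (u' * u'^-1 = 1)%R by rewrite divrr.
  move: (u^-1)%R (u'^-1)%R => U U' E' E.
  transitivity (U * U' * (c * (u * U) + a * u') + a * U * (1 - u' * U'))%R.
    by ring.
  by rewrite E E' !mulr1 subrr mulr0 addr0 /u /u'; ring.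
by rewrite [LHS]mulgA => /mulIg ->.
Qed.

Lemma wstJ_wst_col i j k u : i != j -> i != k -> j != k ->
  wst i k u ^ wst i j 1%R = wst j k u.
Proof.
move=> ij ik jk; rewrite !(@wst_def _ _ k) !(conjMg (_ : St R)).
by rewrite !wstJ_ik ?wstJ_ki ?unitr1 // invr1 !mul1r.
Qed.

Lemma wstJ_wst_row i j k u : i != j -> i != k -> j != k ->
  wst k i u ^ wst i j 1%R = wst k j u.
Proof.
move=> ij ik jk; rewrite !(@wst_def _ k) !(conjMg (_ : St R)).
by rewrite !wstJ_ik ?wstJ_ki ?unitr1 // invr1 !mul1r.
Qed.

(** Conjugation by w_23(1) carries the index pair (1, 2) to (1, 3), without
    signs. *)
Lemma dsst_13 a b : (1 + a * b)%R \is a GRing.unit -> dsst 1 3 a b = dsst 1 2 a b.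
Proof.
move=> uu.
have <- : dsst 1 2 a b ^ wst 2 3 1%R = dsst 1 2 a b.
  by rewrite conjgE (dsC uu) mulKg.
rewrite !dsst_def !(conjMg (_ : St R)) (conjVg (_ : St R)) !hst_def
  (conjMg (_ : St R)).
by rewrite !wstJ_ik ?wstJ_ki ?wstJ_wst_row ?unitr1 // invr1 !mul1r.
Qed.

(** Conjugation by w_13(1) carries the index pair (1, 2) to (3, 2), without
    signs. *)
Lemma dsst_32 a b : (1 + a * b)%R \is a GRing.unit -> dsst 3 2 a b = dsst 1 2 a b.
Proof.
move=> uu.
have <- : dsst 1 2 a b ^ wst 1 3 1%R = dsst 1 2 a b.
  by rewrite conjgE (dsC uu) mulKg.
rewrite !dsst_def !(conjMg (_ : St R)) (conjVg (_ : St R)) !hst_def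
  (conjMg (_ : St R)).
by rewrite !wstJ_ik ?wstJ_ki ?wstJ_wst_col ?unitr1 // invr1 !mul1r.
Qed.

Lemma dsst_LU13 a b (u := (1 + a * b)%R) : u \is a GRing.unit ->
  xst 1 3 a * xst 3 1 b =
  dsst 1 2 a b * (xst 3 1 (b / u)%R * hst 1 3 u * xst 1 3 (a / u)%R).
Proof. by move=> uu; rewrite dsst_LU dsst_13 //
  -(dsC uu (xst 3 1 _)) -!mulgA. Qed.

Lemma dsst_LU32 a b (u := (1 + a * b)%R) : u \is a GRing.unit ->
  xst 3 2 a * xst 2 3 b =
  dsst 1 2 a b * (xst 2 3 (b / u)%R * hst 3 2 u * xst 3 2 (a / u)%R).
Proof. by move=> uu; rewrite dsst_LU dsst_32 //
  -(dsC uu (xst 2 3 _)) -!mulgA. Qed.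

(** Here x_21(bc) is expanded as the commutator of x_23(b) and x_31(c), and
    x_12(a) is moved through it.  The commuting letters are ordered so that
    x_13(ab) meets x_31(c) and x_32(-ca) meets x_23(-b): both pairs have
    1 + abc as the unit of their triangular factorisation. *)
Lemma xst12_xst21 a b c :
  xst 1 2 a * xst 2 1 (b * c)%R =
  xst 2 3 b * (xst 1 3 (a * b)%R * (xst 3 1 c * (xst 3 2 (- (c * a))%R *
  (xst 2 3 (- b)%R * (xst 1 3 (- (a * b))%R *
    (xst 3 2 (c * a)%R * (xst 3 1 (- c)%R * xst 1 2 a))))))).
Proof.
rewrite (@xst_commutator _ 2 3 1) // -!mulgA.
have E1 d g : xst 1 2 a * (xst 2 3 d * g) = xst 2 3 d *
  (xst 1 3 (a * d)%R * (xst 1 2 a * g)).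
  by rewrite (mulg_tail (@xst_swap _ 1 2 3 _ _ _ _ _)) //
    (@xst_comm _ 1 3 2 3) // -!mulgA.
have E2 d g : xst 1 2 a * (xst 3 1 d * g) = xst 3 2 (- (d * a))%R *
  (xst 3 1 d * (xst 1 2 a * g)).
  by rewrite (mulg_tail (@xst_swapV _ 3 1 2 _ _ _ _ _)) // -!mulgA.
rewrite E1 E2 E1 -[xst 3 1 (- c)%R]mulg1 E2 !mulrN mulNr opprK mulg1.
by rewrite (mulg_tail (@xst_comm _ 3 2 3 1 _ _ _ _ _ _)) // -!mulgA mulg1.
Qed.

(** The two pairs singled out in [xst12_xst21] are factored by [dsst_LU]; in
    the rest every letter cancels except those of the direct factorisation of
    x_12(a) x_21(bc). *)
Lemma dsst_mulr_hst a b c (u := (1 + a * (b * c))%R) : u \is a GRing.unit ->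
  dsst 1 2 a (b * c)%R * hst 1 2 u =
  dsst 1 2 (a * b)%R c * dsst 1 2 (- (c * a))%R (- b)%R * hst 1 3 u * hst 3 2 u.
Proof.
move=> uu; have E := dsst_LU12 uu; move: E; rewrite xst12_xst21.
have u1 : (1 + a * b * c)%R = u by rewrite /u mulrA.
have u2 : (1 + - (c * a) * - b)%R = u by rewrite /u; ring.
have uu1 : (1 + a * b * c)%R \is a GRing.unit by rewrite u1.
have uu2 : (1 + - (c * a) * - b)%R \is a GRing.unit by rewrite u2.
rewrite (mulg_tail (dsst_LU13 uu1)) (mulg_tail (dsst_LU32 uu2)) u1 u2 -/u.
have cl (g y z : St R) : central g -> y * (g * z) = g * (y * z).
  by move=> gc; rewrite !mulgA gc.
(* The two symbols are central and are moved to the front. *)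
have := dsC uu1; have := dsC uu2.
move: (dsst 1 2 (a * b)%R c) (dsst 1 2 (- (c * a))%R (- b)%R) => D1 D2 D2c D1c.
rewrite -!mulgA (cl D1) // (cl D2 (xst 1 3 _)) // (cl D2 (hst _ _ _)) //
  !(cl D2 (xst _ _ _)) //.
(* x_23(b) travels right past h_13(u), where it cancels x_23(-b/u). *)
rewrite (mulg_tail (@xst_swap _ 2 3 1 _ _ _ _ _)) // -!mulgA.
rewrite (mulg_tail (conjgC (xst 2 3 b) (hst 1 3 u))) hstJ // -!mulgA /wt /= mul1r.
rewrite (mulg_tail (@xst_comm _ 2 3 1 3 _ _ _ _ _ _)) //
  -!mulgA (mulg_tail (xstD _ _ _ _)).
rewrite mulNr [(u^-1 * b)%R]mulrC subrr xst0 mul1g.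
(* x_13(ab/u) travels right past h_32(u), where it cancels x_13(-ab). *)
rewrite (mulg_tail (conjgC (xst 1 3 _) (hst 3 2 u))) hstJ // -!mulgA /wt /= mul1r.
rewrite [(u * _)%R]mulrC divrK //.
rewrite (mulg_tail (@xst_swap _ 1 3 2 _ _ _ _ _)) //
  -!mulgA (mulg_tail (xstD _ _ _ _)) subrr xst0 mul1g.
(* x_12(a) travels left through x_31 and x_32 and becomes x_12(a/u); the
   letters x_32 cancel. *)
rewrite (@xst_swap _ 3 1 2) // -!mulgA.
rewrite (mulg_tail (xstD 3 2 (c * a)%R _)) [(- c * a)%R]mulNr subrr xst0 mul1g.
rewrite (mulg_tail (@xst_comm _ 3 2 1 2 _ _ _ _ _ _)) //
  -!mulgA (mulg_tail (xstD _ _ _ _)).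
have -> : (a * b * (- (c * a) / u) + a = a / u)%R.
  apply: (mulIr uu); rewrite mulrDl divrK // -(mulrA (a * b)%R) divrK //.
  by rewrite /u; ring.
rewrite -(@xst_comm _ 3 1 3 2) // (mulg_tail (@xst_swapV _ 3 1 2 _ _ _ _ _)) //
  -!mulgA.
rewrite (@xst_comm _ 1 2 3 2) // (mulg_tail (@xst_comm _ 3 1 3 2 _ _ _ _ _ _))
  // -!mulgA.
rewrite (mulg_tail (xstD 3 2 _ _)) !mulNr opprK [(c * (a / u))%R]mulrA subrr
  xst0 mul1g.
(* x_31(-c) travels left past both h, where it cancels x_31(c/u). *)
have cV (g y z : St R) : g * (y * z) = (y ^ g^-1) * (g * z).
  by rewrite conjgE invgK !mulgA mulgVK.
rewrite (cV (hst 3 2 u)) hstJV // (cV (hst 1 3 u)) hstJV //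
  (mulg_tail (xstD _ _ _ _)) /wt /=.
rewrite [(c / u + _)%R](_ : _ = 0)%R; last first.
  by rewrite mulr1 !mulrN mulrA mulrVK // [(u^-1 * c)%R]mulrC subrr.
rewrite xst0 mul1g mulrA.
move=> E; apply: (mulgI (xst 2 1 (b * c / u)%R));
  apply: (mulIg (xst 1 2 (a / u)%R)).
rewrite -!mulgA (cl D1) // (cl D2) // E.
by rewrite (cl (dsst 1 2 a _)) //; apply: dsC.
Qed.

(** The factors h in [dsst_mulr_hst] depend on u = 1 + abc only.  Their
    discrepancy is therefore found at a = -1, b = 1, c = 1 - u, where it is
    <1 - u, -1>; this, and the signs of <-ca, -b>, are removed by rescaling
    with -1, because <u - 1, 1> vanishes. *)
Lemma dsst_mulr a b c : (1 + a * (b * c))%R \is a GRing.unit ->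
  dsst 1 2 a (b * c)%R = dsst 1 2 (a * b)%R c * dsst 1 2 (c * a)%R b.
Proof.
move=> uu; have := dsst_mulr_hst uu; set u := (1 + a * (b * c))%R in uu *.
have n1 : (-1 : R)%R \is a GRing.unit by rewrite unitrN1.
have Ek : (1 + -1 * (1 * (1 - u)) = u)%R by ring.
have uk : (1 + -1 * (1 * (1 - u)))%R \is a GRing.unit by rewrite Ek.
have := dsst_mulr_hst uk; rewrite Ek mul1r mulr1 mulrN1 opprK.
have eu : (1 - (1 - u) = u)%R by ring.
rewrite !dsst_N1 ?eu // !mul1g => K.
have ec : (1 + c * a * b = u)%R by rewrite /u; ring.
have uc : (1 + c * a * b)%R \is a GRing.unit by rewrite ec.
have := dsst_scale uc n1; rewrite invrN1 !mulN1r => ->.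
have uc1 : (1 + (u - 1) * 1)%R \is a GRing.unit.
  by rewrite mulr1 addrC subrK.
have := dsst_scale uc1 n1; rewrite dsst_r1 //; last by rewrite addrC subrK.
rewrite invrN1 !mulN1r opprB mulr1 [(1 + (u - 1))%R]addrC subrK.
move=> S H; rewrite ec [dsst 1 2 (- (c * a))%R _ * _](_ : _ = dsst 1 2
  (- (c * a))%R (- b)%R * (dsst 1 2 (1 - u)%R (-1)%R)^-1); last first.
  by congr (_ * _); apply: (mulgI (dsst 1 2 (1 - u)%R (-1)%R)); rewrite -S divgg.
apply: (mulIg (hst 1 2 u)); rewrite H -!mulgA; congr (_ * (_ * _)).
by rewrite K -!mulgA mulKg.
Qed.

(** Rescaling by - 1/a reduces to <-1, - ab>, which vanishes. *)
Lemma dsst_unit a b : a \is a GRing.unit -> (1 + a * b)%R \is a GRing.unit ->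
  dsst 1 2 a b = symbst (1 + a * b)%R (- a^-1)%R.
Proof.
move=> ua uu; have uV : (- a^-1)%R \is a GRing.unit by rewrite unitrN unitrV.
rewrite (dsst_scale uu uV) invrN invrK mulNr mulVr // dsst_N1 ?mul1g //.
by rewrite mulNr opprK.
Qed.

(** Each use of the product rule splits off one factor t from the second
    argument, at the cost of the same symbol <a t^n, t>. *)
Lemma dsst_power a t n : (1 + a * t ^+ n.+1)%R \is a GRing.unit ->
  dsst 1 2 (a * t ^+ n)%R t ^+ n.+1 = dsst 1 2 a (t ^+ n.+1)%R.
Proof.
elim: n a => [|n IH] a uu; first by rewrite !expr1 expr0 mulr1.
have uu' : (1 + a * t * t ^+ n.+1)%R \is a GRing.unit by rewrite -mulrA -exprS.
rewrite [in RHS]exprS dsst_mulr -?exprS // -(IH _ uu') -mulrA -exprS.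
by rewrite [(_ * a)%R]mulrC -expgSr.
Qed.

End DennisStein.

(** * The morphism rho_t *)

Section K2Milnor.
Variables (R : idomainType) (phi : {multiplicative K2M R -> K2 R}).
Variables (phi_inv : K2 R -> K2M R).
Hypotheses (phi_natural : natural_K2 phi).
Hypotheses (phiK : cancel phi phi_inv) (phi_invK : cancel phi_inv phi).

Let phiM : {morph phi : y z / y * z}. Proof. exact: gmulfM. Qed.

(** By surjectivity of phi, the Steinberg symbols generate K_2(R). *)
Lemma K2_central (z : K2 R) : central (val z).
Proof.
have sC (a b : units R) : central (val (steinberg a b)).
  by rewrite steinbergE; apply: symbst_central; apply: valP.
rewrite -[z]phi_invK; elim/(@pres_ind _ (@milnor_rel R)): (phi_inv z) =>
  [|y1 y2 H1 H2|[a b]|[a b]] s.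
- rewrite [phi _](morphg1 phiM); apply/commute_sym/commute1.
- rewrite [phi _]gmulfM valM.
  by apply/commute_sym/commuteM; apply/commute_sym; [apply: H1|apply: H2].
- rewrite [phi _](phi_natural a b); exact: sC.
- rewrite [phi _](morphgV phiM (msymbol a b)) [X in commute X]gmulfV phi_natural.
  exact/commute_sym/commuteV/commute_sym/sC.
Qed.

Lemma dsst_central (a b : R) : (1 + a * b)%R \is a GRing.unit -> central
  (dsst 1 2 a b).
Proof. by move=> uu; rewrite -dennis_steinE; apply: K2_central. Qed.

Lemma phi_invM : {morph phi_inv : y z / y * z}.
Proof. exact: can2_gmulfM phiK phi_invK. Qed.

Definition uopp (S : comUnitRingType) (a : units S) : units S :=
  to_unit (etrans (unitrN (val a)) (valP a)).

Variable t : R.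
Hypothesis t0 : t != 0%R.

Lemma rho_ds (u : oneplus t) (a : R) : val (oneplus_incl u) = (1 + t * a)%R ->
  val (rho u) = dsst 1 2 a t.
Proof.
move=> ua; have ut : (1 + a * t)%R \is a GRing.unit.
  by rewrite mulrC -ua; apply: valP.
by rewrite (rhoE ut _ ua) ?dennis_steinE //; apply: mulfI.
Qed.

(** The coefficient of t in (1 + ta)(1 + tb) is a + b (1 + at), to which
    [dsst_addl] applies. *)
Lemma rhoM : {morph @rho R t : u v / u * v}.
Proof.
move=> u v; apply: val_inj; rewrite valM.
have [ua va] := (oneplus_coefE u, oneplus_coefE v).
move: (oneplus_coef u) (oneplus_coef v) ua va => a b ua va.
have uu : (1 + a * t)%R \is a GRing.unit by rewrite mulrC -ua; apply: valP.
have uv : (1 + b * t)%R \is a GRing.unit by rewrite mulrC -va; apply: valP.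
rewrite (rho_ds ua) (rho_ds va) -dsst_addl //; last exact: dsst_central.
apply: rho_ds.
rewrite [LHS](_ : _ = val (oneplus_incl u) * val (oneplus_incl v))%R //.
by rewrite ua va; ring.
Qed.

(** For u = 1 + a t^(n+1) the left side is <a t^n, t>^(n+1), that is,
    <a, t^(n+1)>, and a is a unit.  The case n = 0 gives rho_t on the generators
    1 + tw; the other cases are the Steinberg relations for t^(n+1) a in R_t. *)
Lemma rho_power (u : oneplus t) (a : units R) n :
  val (oneplus_incl u) = (1 + val a * t ^+ n.+1)%R ->
  phi_inv (rho u) ^+ n.+1 = msymbol (oneplus_incl u) (uopp a^-1).
Proof.
move=> ua; apply: (can_inj phiK); rewrite (morphgX phiM) phi_invK phi_natural.
have vM : {morph (val : K2 R -> St R) : y z / y * z} by exact: valM.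
apply: val_inj; rewrite (morphgX vM) steinbergE ua.
have uu : (1 + val a * t ^+ n.+1)%R \is a GRing.unit by rewrite -ua; apply: valP.
have -> : \val (rho u) = dsst 1 2 (val a * t ^+ n)%R t.
  by apply: rho_ds; rewrite ua exprS mulrCA.
rewrite dsst_power //; last exact: dsst_central.
by rewrite dsst_unit //; [exact: dsst_central|exact: valP].
Qed.

End K2Milnor.

Local Close Scope group_scope.

(** * Steinberg pairings *)

Section Pairing.
Variables (S : comUnitRingType) (V : zmodType).
Implicit Types x y z : units S.

(** Exactly the data of a morphism on K_2^M: see [pairing_lift] and
    [msymbol_pairing]. *)
Record steinberg_pairing (f : units S -> units S -> V) : Prop := {
  pairingMl : forall x y z, f (x * y)%g z = f x z + f y z;
  pairingMr : forall x y z, f z (x * y)%g = f z x + f z y;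
  pairing_steinberg : forall x y, val y = 1 - val x -> f x y = 0
}.

Lemma hom_one (p : units S -> V) : (forall x y, p (x * y)%g = p x + p y) ->
  p 1%g = 0.
Proof. by move=> pM; apply: (addrI (p 1%g)); rewrite -pM mulg1 addr0. Qed.

Lemma hom_inv (p : units S -> V) : (forall x y, p (x * y)%g = p x + p y) ->
  forall x, p x^-1%g = - p x.
Proof.
by move=> pM x; apply: (addrI (p x)); rewrite -pM divgg subrr (hom_one pM).
Qed.

Lemma hom_exp (p : units S -> V) : (forall x y, p (x * y)%g = p x + p y) ->
  forall x n, p (x ^+ n)%g = p x *+ n.
Proof.
by move=> pM x; elim=> [|n IH]; rewrite ?(hom_one pM) // expgS pM IH mulrS.
Qed.

Variable f : units S -> units S -> V.
Hypothesis fP : steinberg_pairing f.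
Let fMl := pairingMl fP.
Let fMr := pairingMr fP.

Lemma pairingVl x y : f x^-1%g y = - f x y.
Proof. exact: (hom_inv (p := f^~ y)). Qed.
Lemma pairingVr x y : f x y^-1%g = - f x y.
Proof. exact: (hom_inv (p := f x)). Qed.

(** This is the identity - x = (1 - x) / (1 - 1/x). *)
Lemma pairing_opp_unit x : 1 - val x \is a GRing.unit -> f x (uopp x) = 0.
Proof.
move=> ux; pose y := to_unit ux.
have vx := valP x.
have E : val (y * (uopp x)^-1)%g = 1 - val (x^-1)%g.
  rewrite [LHS](_ : _ = val y / - val x) // invrN mulrN mulrBl div1r divrr //.
  by rewrite opprB.
have := pairingVl x (y * (uopp x)^-1)%g; rewrite (pairing_steinberg fP E) fMr
  pairingVr.
by rewrite (pairing_steinberg fP (x := x) (y := y)) // add0r opprK.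
Qed.

Lemma pairing_oppM x y :
  f (x * y)%g (uopp (x * y)%g) = f x (uopp x) + f y (uopp y) + (f x y + f y x).
Proof.
rewrite fMl.
have -> : uopp (x * y)%g = (uopp x * y)%g by apply: val_inj; rewrite /= mulNr.
have -> : f y (uopp x * y)%g = f y (uopp y * x)%g.
  by congr f; apply: val_inj; rewrite /= !mulNr mulrC.
by rewrite !fMr addrACA.
Qed.

Section Stable.
Variables (R : comUnitRingType) (g : {rmorphism R -> S}).
Hypothesis R5 : weakly_stable R 5.

Lemma stable4 (a b c d : R) : exists u : units R,
  [/\ 1 - val u * a \is a GRing.unit, 1 - val u * b \is a GRing.unit,
      1 - val u * c \is a GRing.unit & 1 - val u * d \is a GRing.unit].
Proof.
have [u uu H] := R5 (fun i : 'I_4 => - [:: a; b; c; d]`_i).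
exists (to_unit uu) => /=.
have := (H 0, H 1, H 2%:R, H 3%:R); rewrite /= !mulrN.
by case=> [[[]]].
Qed.

(** Write d(x) for f(x, -x) and s(x, y) for f(x, y) + f(y, x); then
    d(xy) = d(x) + d(y) + s(x, y).  If 1 - u and 1 - ux are units, then
    d(u) = d(ux) = 0, so d(x) = - s(u, x).  Stability provides such a u, and then
    a v for which both v and uv are such elements as well; from
    s(uv, x) = s(u, x) + s(v, x) follows d(x) = 2 d(x).  The element x only has to
    come from R, not from a unit of R, so that t in R_t is covered. *)
Lemma pairing_opp (r : R) x : val x = g r -> f x (uopp x) = 0.
Proof.
move=> xr.
have d0 (z : R) y : val y = g z -> 1 - z \is a GRing.unit -> f y (uopp y) = 0.
  by move=> yz zu; apply: pairing_opp_unit;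
    rewrite yz -(rmorph1 g) -rmorphB rmorph_unit.
have [u [u1 ur _ _]] := stable4 1 r 0 0.
have [v [v1 vr vu vur]] := stable4 1 r (val u) (val u * r).
pose U := units_map g u; pose W := units_map g v.
have dU : f U (uopp U) = 0 by apply: (d0 (val u)); rewrite // -[val u]mulr1.
have dW : f W (uopp W) = 0 by apply: (d0 (val v)); rewrite // -[val v]mulr1.
have dWU : f (W * U)%g (uopp (W * U)%g) = 0.
  by apply: (d0 (val v * val u)); rewrite // rmorphM.
have dUx : f (U * x)%g (uopp (U * x)%g) = 0.
  by apply: (d0 (val u * r)); rewrite // rmorphM -xr.
have dWx : f (W * x)%g (uopp (W * x)%g) = 0.
  by apply: (d0 (val v * r)); rewrite // rmorphM -xr.
have dWUx : f (W * U * x)%g (uopp (W * U * x)%g) = 0.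
  by apply: (d0 (val v * (val u * r))); rewrite // !rmorphM -xr mulrA.
move: dUx dWx dWUx; rewrite (pairing_oppM U x) (pairing_oppM W x)
  (pairing_oppM (W * U)%g x).
rewrite dWU dU dW !add0r fMl fMr addrACA => E1 /eqP E2.
move: E2; rewrite addr_eq0 => /eqP E2; rewrite -[f W x + f x W]opprK -E2.
by rewrite [- _ + _]addrC addrA E1 add0r => /eqP; rewrite oppr_eq0 => /eqP.
Qed.

Lemma pairing_antisym (r s : R) x y : val x = g r -> val y = g s ->
  f x y = - f y x.
Proof.
move=> xr ys; have := pairing_oppM x y.
rewrite (pairing_opp xr) (pairing_opp ys) (@pairing_opp (r * s));
  last by rewrite rmorphM -xr -ys.
by rewrite !add0r => /eqP; rewrite eq_sym addr_eq0 => /eqP.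
Qed.

End Stable.
End Pairing.

(** * Units of R_t *)

Section Away.
Variables (R : idomainType) (t : R).
Hypothesis t_prime : prime_element t.
Local Notation "x %:F" := (FracField.tofrac x).

Let t0 : t != 0 := prime_element_neq0 t_prime.
Let tF0 : t%:F != 0. Proof. by rewrite tofrac_eq0. Qed.

Lemma principalP a : reflect (exists b, a = t * b) (a \in principal t).
Proof. exact: asboolP. Qed.

Lemma t_ndvd_unit a : t * a \isn't a GRing.unit.
Proof.
apply/negP => ua; have [_ [_ /negP t1 _] _] := t_prime.
apply: t1; apply/principalP.
by exists (a / (t * a)); rewrite mulrA divrr.
Qed.

(** A factor t of t^N divides r or s, t being prime, and can be cancelled. *)
Lemma split_tX (N : nat) (r s : R) : r * s = t ^+ N ->
  exists i, exists2 a, a \is a GRing.unit & r = t ^+ i * a.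
Proof.
have [_ _ tp] := t_prime.
elim: N r s => [|N IH] r s rs.
  exists 0, r; last by rewrite mul1r.
  by apply/unitrPr; exists s.
have /tp/orP[] : r * s \in principal t by apply/principalP; exists (t ^+ N);
  rewrite rs exprS.
  move=> /principalP[r' rE]; have /(mulfI t0) E : t * (r' * s) = t * t ^+ N by
    rewrite mulrA -rE -exprS.
  by have [i [a ua r'E]] := IH _ _ E; exists i.+1, a; rewrite //
    rE r'E exprS mulrA.
move=> /principalP[s' sE]; have /(mulfI t0) E : t * (r * s') = t * t ^+ N by
  rewrite mulrCA -sE -exprS.
exact: IH E.
Qed.

Local Notation U := (units (away t)).
Local Notation iota := (units_map (@to_away R t)).
Definition tau : U := to_unit (away_t_unit t0).

Lemma val2M (x y : U) : val (val (x * y)%g) = val (val x) * val (val y).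
Proof. exact: (rmorphM (val : away t -> {fraction R}) (val x) (val y)). Qed.

(** The numerators of a unit of R_t and of its inverse have a power of t as
    product. *)
Lemma away_unit_decomp (x : U) : exists (m : int) (a : units R),
  val (val x) = t%:F ^ m * (val a)%:F.
Proof.
have /andP[x0 /asboolP[s [l sE]]] := valP x.
have /asboolP[r [k rE]] := valP (val x).
have rs : r * s = t ^+ (k + l).
  apply/eqP; rewrite -tofrac_eq rmorphM rmorphXn /= exprD.
  have := mulfV x0; rewrite sE {1}rE mulf_div.
  move/(congr1 (fun z => z * (t%:F ^+ k * t%:F ^+ l))).
  by rewrite mul1r divfK ?mulf_neq0 ?expf_neq0 // => /eqP.
have [i [a ua ra]] := split_tX rs.
exists (i%:Z - k%:Z), (to_unit ua).
by rewrite rE ra expfzDr // -exprnP -exprnN /= rmorphM rmorphXn /= mulrAC.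
Qed.

Lemma away_unit_unique (m n : int) (a b : units R) :
  t%:F ^ m * (val a)%:F = t%:F ^ n * (val b)%:F -> m = n /\ a = b.
Proof.
wlog mn : m n a b / (m <= n)%R => [H|E].
  have /orP[] := Order.TotalTheory.le_total m n; first exact: H.
  by move=> nm /esym/(H _ _ _ _ nm) [].
have {}E : (val a)%:F = (t%:F ^ (n - m)) * (val b)%:F.
  apply: (mulfI (expfz_neq0 m tF0)); rewrite E mulrA -expfzDr //.
  by congr (_ ^ _ * _); rewrite addrC subrK.
move: E; have : 0 <= n - m by rewrite Num.Theory.subr_ge0.
case nm: (n - m) => [[|k]|] // _; rewrite -exprnP.
  rewrite mul1r => /eqP; rewrite tofrac_eq => /eqP E; split; last exact: val_inj.
  by apply/eqP; rewrite eq_sym -subr_eq0 nm.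
rewrite -rmorphXn -rmorphM /= => /eqP; rewrite tofrac_eq => /eqP E.
have va : val a \is a GRing.unit := valP a.
by move: va; rewrite [val a]E exprS -mulrA (negPf (t_ndvd_unit _)).
Qed.

Definition ord (x : U) : int := sval (cid (away_unit_decomp x)).
Definition unitpart (x : U) : units R := sval
  (cid (svalP (cid (away_unit_decomp x)))).

Lemma ord_unitpart x : val (val x) = t%:F ^ ord x * (val (unitpart x))%:F.
Proof. exact: (svalP (cid (svalP (cid (away_unit_decomp x))))). Qed.

Lemma ord_unitpartP x m a : val (val x) = t%:F ^ m * (val a)%:F ->
  ord x = m /\ unitpart x = a.
Proof. by rewrite ord_unitpart; apply: away_unit_unique. Qed.

Lemma ord_unitpartM x y :
  ord (x * y)%g = ord x + ord y /\ unitpart (x * y)%g =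
    (unitpart x * unitpart y)%g.
Proof.
apply: ord_unitpartP; rewrite val2M.
by rewrite !ord_unitpart mulrACA -expfzDr // -rmorphM.
Qed.

Lemma ord_unitpart_iota a : ord (iota a) = 0 /\ unitpart (iota a) = a.
Proof. by apply: ord_unitpartP; rewrite mul1r. Qed.

Lemma ord_unitpart_tau : ord tau = 1 /\ unitpart tau = 1%g.
Proof. by apply: ord_unitpartP; rewrite expr1z rmorph1 mulr1. Qed.

Lemma hom_away (V : zmodType) (p : U -> V) :
  (forall x y, p (x * y)%g = p x + p y) ->
  forall x, p x = p tau *~ ord x + p (iota (unitpart x)).
Proof.
move=> pM x.
have tauX k : val (val (tau ^+ k)%g) = t%:F ^+ k.
  by elim: k => [|k IH]; rewrite ?expg0 ?rmorph1 // expgS exprS -IH val2M.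
have := ord_unitpart x; case: (ord x) => k xE.
  rewrite -pmulrn -hom_exp // -pM; congr p; do 2!apply: val_inj.
  by rewrite xE -exprnP val2M tauX.
apply: (addIr (p tau *+ k.+1)); rewrite NegzE mulrNz -pmulrn addrAC addNr add0r.
rewrite -hom_exp // -pM; congr p; do 2!apply: val_inj.
rewrite val2M tauX xE.
by rewrite NegzE -exprnN mulrAC mulVf ?mul1r ?expf_neq0.
Qed.

End Away.

(** * Pairings on R_t *)

Section Glue.
Variables (R : idomainType) (t : R) (t_prime : prime_element t) (V : zmodType).
Hypothesis R5 : weakly_stable R 5.
Local Notation U := (units (away t)).
Local Notation iota := (units_map (@to_away R t)).
Local Notation tau := (tau t_prime).
Local Notation ord := (ord t_prime).
Local Notation up := (unitpart t_prime).
Local Notation nu := (uopp (1%g : units R)).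

(** A pairing on R_t is determined by its values on pairs of units of R and
    on pairs (a, t): {t, a} is - {a, t} by antisymmetry, and {t, -t} = 0 gives
    {t, t} = {-1, t}. *)
Lemma pairing_away (f : U -> U -> V) : steinberg_pairing f -> forall x y,
  f x y = f (iota (up x)) (iota (up y)) + f (iota (up x)) tau *~ ord y
          - f (iota (up y)) tau *~ ord x + f (iota nu) tau *~ (ord x * ord y).
Proof.
move=> fP x y.
have fMl := pairingMl fP; have fMr := pairingMr fP.
have anti a : f tau (iota a) = - f (iota a) tau.
  exact: (@pairing_antisym _ _ _ fP _ (@to_away R t) R5 t (val a)).
have ft : f tau tau = f (iota nu) tau.
  have := @pairing_opp _ _ _ fP _ (@to_away R t) R5 t tau erefl.
  have -> : uopp tau = (iota nu * tau)%g.
    by apply: val_inj; rewrite /= rmorphN rmorph1 mulN1r.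
  by rewrite fMr anti => /eqP; rewrite addrC subr_eq0 => /eqP.
rewrite (hom_away t_prime (p := f^~ y)) // (hom_away t_prime (p := f tau)) //.
rewrite (hom_away t_prime (p := f (iota _))) // anti ft.
rewrite mulrzDl -mulrzA mulNrz [(ord y * _)%R]mulrC.
by rewrite [LHS]addrC -[RHS]addrA; congr (_ + _); apply: addrC.
Qed.

Variables (Q : units R -> units R -> V) (P : units R -> V).
Hypothesis QP : steinberg_pairing Q.
Hypothesis PM : forall a b, P (a * b)%g = P a + P b.
(** The Steinberg relation for t^(m+1) a, once {b, t} is sent to P b. *)
Hypothesis compat : forall (m : nat) (a b : units R),
  val b = 1 - t ^+ m.+1 * val a -> Q a b = P b *+ m.+1.

(** The right side of [pairing_away], with Q and P as the prescribed
    values. *)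
Definition glue (x y : U) : V :=
  Q (up x) (up y) + P (up x) *~ ord y - P (up y) *~ ord x
  + P nu *~ (ord x * ord y).

Let QMl := pairingMl QP.
Let QMr := pairingMr QP.

Let Qanti a b : Q a b = - Q b a.
Proof. exact: (@pairing_antisym _ _ _ QP _ idfun R5 (val a) (val b)). Qed.

Let Qopp a : Q a (uopp a) = 0.
Proof. exact: (@pairing_opp _ _ _ QP _ idfun R5 (val a)). Qed.

Let Pnu : P nu + P nu = 0.
Proof.
rewrite -PM -(hom_one PM); congr P; apply: val_inj.
by rewrite [LHS](_ : _ = -1 * -1) // mulrNN mulr1.
Qed.

Let Pnuz k : - (P nu *~ k) = P nu *~ k.
Proof. by rewrite -mulNrz; congr (_ *~ _); apply/eqP;
  rewrite eq_sym -addr_eq0 Pnu. Qed.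

Lemma glueMl x y z : glue (x * y)%g z = glue x z + glue y z.
Proof.
rewrite /glue; have [-> ->] := ord_unitpartM t_prime x y.
rewrite QMl PM mulrzDl mulrzDr mulrDl mulrzDr opprD.
by rewrite [in RHS]addrACA [X in _ = X + _]addrACA [X in _ = X + _ + _]addrACA.
Qed.

Lemma glue_anti x y : glue x y = - glue y x.
Proof.
rewrite /glue !opprD opprK Pnuz Qanti [ord y * _]mulrC; congr (_ + _).
by rewrite addrAC.
Qed.

Lemma glueMr x y z : glue z (x * y)%g = glue z x + glue z y.
Proof. by rewrite !(glue_anti z) glueMl opprD. Qed.

(** When x is divisible by t, its complement 1 - x is an element of R prime
    to t, so it has order 0 and the relation is [compat]. *)
Lemma glue_pos x y : (0 < ord x) -> val y = 1 - val x -> glue x y = 0.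
Proof.
move=> x0 yx.
have tF0 : FracField.tofrac t != 0 by rewrite tofrac_eq0
  (prime_element_neq0 t_prime).
have yx2 : val (val y) = 1 - val (val x) by rewrite yx rmorphB rmorph1.
have := ord_unitpart t_prime x; have := ord_unitpart t_prime y.
rewrite /glue; move: (up x) (up y) (ord y) => a b n.
case: (ord x) x0 => [[|k]|] // _; rewrite -exprnP -rmorphXn -rmorphM yx2 => yE xE.
move: yE; rewrite xE -[1]tofrac1 -rmorphB /= => yE.
(* If n > 0, then t divides 1; if n < 0, then t divides the unit b. *)
have n0 : n = 0.
  case: n yE => [[|n]|n] //; rewrite ?NegzE -?exprnN -?exprnP.
    rewrite -rmorphXn -rmorphM /= => /eqP;
      rewrite tofrac_eq !exprS -!mulrA subr_eq -mulrDr.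
    by move=> /eqP E; have := t_ndvd_unit t_prime
      (t ^+ n * val b + t ^+ k * val a); rewrite -E unitr1.
  move=> /(congr1 (fun z => FracField.tofrac t ^+ n.+1 * z)).
  rewrite mulrA divff ?expf_neq0 // mul1r -rmorphXn -rmorphM => /eqP;
    rewrite tofrac_eq => /eqP E.
  have va : val b \is a GRing.unit := valP b.
  by move: va; rewrite -[val b]E exprS -mulrA (negPf (t_ndvd_unit t_prime _)).
move: yE; rewrite n0 expr0z mul1r => /eqP; rewrite tofrac_eq => /eqP yE.
by rewrite (compat (esym yE)) mulr0z mulr0 mulr0z !addr0 -pmulrn subrr.
Qed.

(** For x = t^m a the terms leave m (m + 1) P(-1), and P(-1) is killed
    by 2. *)
Lemma glue_opp x : glue x (uopp x) = 0.
Proof.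
have E : val (val (uopp x)) = FracField.tofrac t ^ ord x * FracField.tofrac
  (val (uopp (up x))).
  by rewrite /= rmorphN mulrN -ord_unitpart.
rewrite /glue; have [-> ->] := ord_unitpartP t_prime E.
rewrite Qopp add0r.
have -> : uopp (up x) = (nu * up x)%g by apply: val_inj; rewrite /= mulN1r.
move: (up x) (ord x) => a m; rewrite PM mulrzDl opprD addrCA subrr addr0 Pnuz.
have [m0|m1] : P nu *~ m = 0 \/ P nu *~ m = P nu.
- have nat_case n : P nu *+ n = 0 \/ P nu *+ n = P nu.
    elim: n => [|n IH]; first by left.
    by rewrite mulrS; case: IH => ->; [right; rewrite addr0|left].
  by case: m => n; rewrite ?NegzE ?mulrNz ?Pnuz -pmulrn; apply: nat_case.
- by rewrite mulrzA m0 mul0rz addr0.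
- by rewrite mulrzA !m1 Pnu.
Qed.

(** As 1 - 1/x = (1 - x) / (- x), bilinearity and [glue_opp] reduce to
    [glue_pos] at 1/x. *)
Lemma glue_neg x y : (ord x < 0) -> val y = 1 - val x -> glue x y = 0.
Proof.
move=> x0 yx.
have ordV : ord x^-1%g = - ord x.
  by apply: hom_inv => z z'; have [] := ord_unitpartM t_prime z z'.
have E : val (y * (uopp x)^-1)%g = 1 - val (x^-1)%g.
  have vx := valP x.
  rewrite [LHS](_ : _ = val y / - val x) // yx invrN mulrN mulrBl div1r divrr //.
  by rewrite opprB.
have gVl : glue x^-1%g (y * (uopp x)^-1)%g = - glue x (y * (uopp x)^-1)%g.
  by apply: (hom_inv (p := glue^~ _)) => *; apply: glueMl.
have gVr : glue x (uopp x)^-1%g = - glue x (uopp x).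
  by apply: (hom_inv (p := glue x)) => *; apply: glueMr.
have := glue_pos _ E; rewrite ordV Num.Theory.oppr_gt0 => /(_ x0).
rewrite gVl glueMr gVr glue_opp oppr0 addr0 => /eqP.
by rewrite oppr_eq0 => /eqP.
Qed.

Lemma glue_pairing : steinberg_pairing glue.
Proof.
split; [exact: glueMl|exact: glueMr|move=> x y yx].
have xy : val x = 1 - val y by rewrite yx opprB addrC subrK.
have [x0|x0|x0] := Num.Theory.ltrgt0P (ord x); first exact: glue_pos.
  exact: glue_neg.
have [y0|y0|y0] := Num.Theory.ltrgt0P (ord y).
- by rewrite glue_anti (glue_pos y0 xy) oppr0.
- by rewrite glue_anti (glue_neg y0 xy) oppr0.
rewrite /glue x0 y0 mulr0 !mulr0z subr0 !addr0.
apply: (pairing_steinberg QP).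
have yx2 : val (val y) = 1 - val (val x) by rewrite yx rmorphB rmorph1.
move: yx2; rewrite !(ord_unitpart t_prime) x0 y0 expr0z !mul1r -[1]tofrac1
  -rmorphB /=.
by move=> /eqP; rewrite tofrac_eq => /eqP.
Qed.

Lemma glue_iota a b : glue (iota a) (iota b) = Q a b.
Proof.
rewrite /glue; have [-> ->] := ord_unitpart_iota t_prime a.
by have [-> ->] := ord_unitpart_iota t_prime b;
  rewrite mulr0 !mulr0z subr0 !addr0.
Qed.

Lemma glue_tau a : glue (iota a) tau = P a.
Proof.
rewrite /glue; have [-> ->] := ord_unitpart_iota t_prime a.
have [-> ->] := ord_unitpart_tau t_prime.
rewrite mul0r !mulr0z subr0 addr0 mulr1z (hom_one (p := Q a)) ?add0r //.
Qed.

End Glue.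

(** * The pushout square *)

(** T with its law written additively, for the integer multiples and the
    lemmas of zmodType. *)
Definition addg (T : abGroupType) : Type := T.

Section AddG.
Variable T : abGroupType.
HB.instance Definition _ := Choice.on (addg T).
Let addA : associative (fun x y : addg T => (x * y)%g : addg T).
Proof. exact: mulgA. Qed.
Let addC : commutative (fun x y : addg T => (x * y)%g : addg T).
Proof. exact: mulgC. Qed.
Let add0 : left_id (1%g : addg T) (fun x y : addg T => (x * y)%g : addg T).
Proof. exact: mul1g. Qed.
Let addN : left_inverse (1%g : addg T) (fun x : addg T => x^-1%g : addg T)
   (fun x y : addg T => (x * y)%g : addg T).
Proof. exact: mulVg. Qed.
HB.instance Definition _ := GRing.isZmodule.Build (addg T) addA addC add0 addN.

Lemma addgX (a : T) n : (a ^+ n)%g = (a : addg T) *+ n :> addg T.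
Proof. by elim: n => // n IH; rewrite expgS mulrS -IH. Qed.
End AddG.

Section Symbols.
Variable S : comUnitRingType.

Lemma msymbolMl (a b c : units S) :
  msymbol (a * b)%g c = (msymbol a c * msymbol b c)%g.
Proof. by rewrite -[RHS]pres_classM; apply/pres_classP/PresRel/MilnorBilinl. Qed.

Lemma msymbolMr (a b c : units S) :
  msymbol c (a * b)%g = (msymbol c a * msymbol c b)%g.
Proof. by rewrite -[RHS]pres_classM; apply/pres_classP/PresRel/MilnorBilinr. Qed.

Lemma msymbol_steinberg (a b : units S) : val b = 1 - val a -> msymbol a b = 1%g.
Proof. by move=> ab; apply/pres_classP/PresRel/MilnorSteinberg. Qed.

Lemma msymbol_pairing (T : abGroupType) (q : {multiplicative K2M S -> T}) :
  steinberg_pairing (fun a b => q (msymbol a b) : addg T).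
Proof.
split=> [a b c|a b c|a b ab]; rewrite ?msymbolMl ?msymbolMr.
- exact: gmulfM.
- exact: gmulfM.
- by rewrite msymbol_steinberg //; apply/morphg1/gmulfM.
Qed.

(** The presentation of K_2^M also has relations that make it commutative;
    they hold because the target is abelian. *)
Lemma pairing_lift (T : abGroupType) (f : units S -> units S -> addg T) :
  steinberg_pairing f ->
  exists r : {multiplicative K2M S -> T}, forall a b, r (msymbol a b) = f a b.
Proof.
move=> fP; pose F (p : units S * units S) : T := f p.1 p.2.
have F_rel u v : milnor_rel u v -> word_eval F u = word_eval F v.
  case=> {u v} [a b c|a b c|a b ab|p q]; rewrite ?word_eval_cat !word_eval_gen.
  - exact: (pairingMr fP b c a).
  - exact: (pairingMl fP a b c).
  - by rewrite /word_eval big_nil; apply: (pairing_steinberg fP).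
  - exact: mulgC.
have [r rE] := multiplicative_of (pres_liftM F_rel).
by exists r => a b; rewrite rE; apply: pres_lift_gen.
Qed.

Lemma K2M_ext (G : groupType) (f g : K2M S -> G) :
  {morph f : y z / (y * z)%g} -> {morph g : y z / (y * z)%g} ->
  (forall a b, f (msymbol a b) = g (msymbol a b)) -> f =1 g.
Proof.
move=> fM gM fg; elim/pres_ind=> [|y z yE zE|[a b]|[a b]].
- by rewrite (morphg1 fM) (morphg1 gM).
- by rewrite (fM y z) (gM y z) yE zE.
- exact: fg.
- by rewrite (morphgV fM) (morphgV gM) -/(msymbol a b) fg.
Qed.

End Symbols.

Theorem proposition4p2
  (R : idomainType) (R_noeth : noetherian R)
  (t : R) (t_prime : prime_element t)
  (A1 : forall x : {fraction R},
     (x \in in_away t) && (x \in in_locprime t) <->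
     exists r : R, x = FracField.tofrac r)
  (A2_stable : weakly_stable R 5)
  (phi : {multiplicative K2M R -> K2 R}) (phi_natural : natural_K2 phi)
  (phi_inv : K2 R -> K2M R)
  (phiK : cancel phi phi_inv) (phi_invK : cancel phi_inv phi)
  (A3 : generates (fun u : oneplus t =>
     exists2 w : R, w \is a GRing.unit & val (oneplus_incl u) = 1 + t * w)) :
  cocartesian
    (@oneplus_incl R t)
    (fun u : oneplus t => phi_inv (rho u))
    (symbol_t (prime_element_neq0 t_prime))
    (K2M_map (@to_away R t)).
Proof.
have t0 := prime_element_neq0 t_prime.
have jM : {morph @oneplus_incl R t : u v / (u * v)%g} by [].
have rM : {morph (fun u : oneplus t => phi_inv (rho u)) : u v / (u * v)%g}.
  move=> u v; rewrite (rhoM phi_natural phi_invK t0).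
  exact: (phi_invM phiK phi_invK).
have hM : {morph symbol_t (prime_element_neq0 t_prime) : u v / (u * v)%g}.
  by move=> u v; rewrite /symbol_t units_mapM msymbolMl.
have kM : {morph K2M_map (@to_away R t) : u v / (u * v)%g} by exact: K2M_mapM.
split=> //.
- move=> u; apply/eqP.
  pose H : {pred oneplus t} := [pred u |
    symbol_t (prime_element_neq0 t_prime) (oneplus_incl u)
      == K2M_map (@to_away R t) (phi_inv (rho u))].
  have hjM : {morph (fun u : oneplus t => symbol_t (prime_element_neq0 t_prime)
    (oneplus_incl u)) : u v / (u * v)%g}.
    by move=> y z; rewrite jM hM.
  have krM : {morph (fun u : oneplus t => K2M_map (@to_away R t)
    (phi_inv (rho u))) : u v / (u * v)%g}.
    by move=> y z; rewrite rM kM.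
  apply: (A3 H) => [|{}u [w uw uE]].
    split=> [|y z /eqP yE /eqP zE]; rewrite inE;
      first by rewrite (morphg1 hjM) (morphg1 krM).
    by rewrite hjM krM (morphgV hjM) (morphgV krM) yE zE.
  have := rho_power phi_natural phiK phi_invK t0 (u := u) (a := to_unit uw)
    (n := 0).
  rewrite expr1 mulrC => /(_ uE); rewrite expg1 inE => ->.
  rewrite K2M_map_symbol /symbol_t.
  set ju := units_map _ (oneplus_incl u).
  have -> : uopp (to_unit uw)^-1%g = (uopp (to_unit uw))^-1%g.
    by apply: val_inj; rewrite /= invrN.
  rewrite (morphgV (units_mapM _)).
  have msM : {morph msymbol ju : y z / (y * z)%g} by move=> y z; apply: msymbolMr.
  (* It remains that the symbol of 1 + tw and - tw is trivial. *)
  rewrite (morphgV msM); apply/eqP/esym/mulg1_eq; rewrite -msM;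
    apply: msymbol_steinberg.
  apply: val_inj; rewrite /= uE -rmorphM -[1]tofrac1 -rmorphB /=.
  by congr (FracField.tofrac _); ring.
- move=> T p q pq.
  have QP := msymbol_pairing q.
  have PM (a b : units R) : (p (a * b)%g : addg T) = (p a : addg T) + p b by
    exact: gmulfM.
  (* By assumption p b is q (rho_t b), as b lies in 1 + tR. *)
  have compat (m : nat) (a b : units R) : val b = 1 - t ^+ m.+1 * val a ->
      (q (msymbol a b) : addg T) = (p b : addg T) *+ m.+1.
    move=> bE.
    have bo : in_oneplus t b.
      by apply/asboolP; exists (- (t ^+ m * val a));
        rewrite bE mulrN mulrA -exprS.
    pose u : oneplus t := exist _ b bo.
    have uE : val (oneplus_incl u) = 1 + val (uopp a) * t ^+ m.+1.
      by rewrite /= bE mulNr mulrC.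
    have := rho_power phi_natural phiK phi_invK t0 (u := u) (a := uopp a)
      (n := m) uE.
    move=> /(congr1 q).
    have qM : {morph q : u v / (u * v)%g} by exact: gmulfM.
    rewrite (morphgX qM) -pq addgX => ->.
    have -> : uopp (uopp a)^-1%g = a^-1%g by apply: val_inj;
      rewrite /= invrN opprK.
    rewrite [RHS](pairingVr QP).
    exact: (@pairing_antisym _ _ _ QP _ idfun A2_stable (val a) (val b)).
  have [r rE] := pairing_lift (glue_pairing t_prime A2_stable QP PM compat).
  have rk : (fun c => r (K2M_map (@to_away R t) c)) =1 q.
    apply: K2M_ext => [u v|u v|a b]; first by rewrite kM gmulfM.
      exact: gmulfM.
    by rewrite K2M_map_symbol rE glue_iota.
  exists r; split=> // [b|r' r'h r'k].
    by rewrite -[RHS](glue_tau t_prime (fun u => p u : addg T) QP) -rE.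
  apply: K2M_ext => [u v|u v|x y]; [exact: gmulfM|exact: gmulfM|].
  rewrite rE [LHS](pairing_away t_prime A2_stable (msymbol_pairing r')) /glue.
  have r'i a b : r' (msymbol (units_map (@to_away R t) a)
      (units_map (@to_away R t) b)) = q (msymbol a b).
    by rewrite -K2M_map_symbol r'k.
  have r't a : r' (msymbol (units_map (@to_away R t) a) (tau t_prime)) = p a.
    exact: r'h.
  by rewrite r'i !r't.
Qed.
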